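(* Let $\phi=(f_0:f_1:f_2):\mathbb{P}^1\to\mathbb{P}^2$ be a generically $1$-to-$1$ parametrization of a plane curve $\mathcal{C}$ of degree $d\geq 2$ over $\mathbb{C}$, and let $d^\vee$ denote the degree of the dual curve $\mathcal{C}^\vee$. For $0\le i<j\le 2$ let $m_{ij}=\partial_sf_i\,\partial_tf_j-\partial_sf_j\,\partial_tf_i$, let $A=\gcd(m_{01},m_{02},m_{12})$, $m_{ij}'=m_{ij}/A$, and set $(f_0^\vee,f_1^\vee,f_2^\vee)=(m_{12}',-m_{02}',m_{01}')$. Then the homogeneous polynomials $f_0^\vee,f_1^\vee,f_2^\vee$ are of degree $d^\vee$ and they define a generically $1$-to-$1$ parametrization $\phi^\vee=(f_0^\vee:f_1^\vee:f_2^\vee):\mathbb{P}^1\to(\mathbb{P}^2)^\vee$ of the dual curve $\mathcal{C}^\vee$.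
   Context: Here $f_0,f_1,f_2\in\mathbb{C}[s,t]$ are homogeneous polynomials of the same degree $d$ with $\gcd(f_0,f_1,f_2)=1$, $\phi(s:t)=(f_0(s,t):f_1(s,t):f_2(s,t))$ has image $\mathcal{C}$, and generically $1$-to-$1$ means that the fiber over a generic point of the image is a single point (so $\deg\mathcal{C}=d$). $(\mathbb{P}^2)^\vee$ is the dual projective plane, the point $(a:b:c)$ corresponding to the line $ax+by+cz=0$ in $\mathbb{P}^2$. The dual curve $\mathcal{C}^\vee\subset(\mathbb{P}^2)^\vee$ is the closure of the set of tangent lines to $\mathcal{C}$ at its smooth points. The $m_{ij}$ are the $2$-minors of the Jacobian matrix of $\phi$ (rows: partial derivatives with respect to $s$ and $t$; columns: $f_0,f_1,f_2$). *)

(* Defs.v *)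
From mathcomp Require Import all_boot all_order all_algebra.
From mathcomp Require Import classical_sets reals.
From mathcomp Require Import mpoly.
From mathcomp Require Import complex.

Set Implicit Arguments.
Unset Strict Implicit.
Unset Printing Implicit Defensive.

Import GRing.Theory.
Local Open Scope ring_scope.
Local Open Scope classical_set_scope.

(* A point of P^n(K) is given by any of its vectors of homogeneous coordinates,
   a nonzero element of 'rV[K]_n.+1, and a subset of P^n(K) by the set of all
   homogeneous coordinate vectors of its points. The value at p : 'rV[K]_n of a
   polynomial G in n variables is G.@[p 0].  The point (a : b : c) of the dual
   plane is the line a x + b y + c z = 0. *)

Section Divisibility.
Variables (K : fieldType) (n : nat).
Implicit Types (A B G : {mpoly K[n]}) (s : seq {mpoly K[n]}).

Definition mdivides B G := exists Q, G = Q * B.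

(* Gcds are only defined up to a nonzero constant, whence a relation. *)
Definition is_gcd A s :=
  (forall G, G \in s -> mdivides A G) /\
  (forall B, (forall G, G \in s -> mdivides B G) -> mdivides B A).

End Divisibility.

Section ProjectiveSets.
Variables (K : fieldType) (n : nat).
Implicit Types (p q : 'rV[K]_n) (S X : set 'rV[K]_n).

Definition same_point p q := exists2 c : K, c != 0 & q = c *: p.

Definition zero_locus (I : set {mpoly K[n]}) : set 'rV[K]_n :=
  [set p : 'rV[K]_n | p != 0 /\ forall G, I G -> G.@[p 0] = 0].

Definition vanishing_forms S : set {mpoly K[n]} :=
  [set G | (exists k, G \is k.-homog) /\ forall p, S p -> G.@[p 0] = 0].

Definition zariski_closure S := zero_locus (vanishing_forms S).

Definition zariski_closed S := zariski_closure S = S.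

(* P holds on a dense Zariski open subset X `\` Z of X. *)
Definition generically X (P : 'rV[K]_n -> Prop) :=
  exists Z, [/\ zariski_closed Z,
                X `<=` zariski_closure (X `\` Z) &
                forall p, (X `\` Z) p -> P p].

End ProjectiveSets.

Section PlaneCurves.
Variable K : fieldType.
Implicit Types (X : set 'rV[K]_3) (F : {mpoly K[3]}) (p l : 'rV[K]_3) (e : nat).

(* F generates the homogeneous ideal of the plane curve X; such an F is unique
   up to a nonzero constant, and e, its degree, is the degree of X. *)
Definition curve_equation X e F :=
  [/\ (0 < e)%N, F != 0, F \is e.-homog, X = zero_locus [set F] &
      forall G, vanishing_forms X G -> mdivides F G].

(* 0 when X is not a plane curve. *)
Definition curve_degree X : nat :=
  xget 0%N [set e | exists F, curve_equation X e F].

Definition gradient F p : 'rV[K]_3 := \row_i (F^`M(i)).@[p 0].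

(* The points p of X with gradient F p != 0 are the smooth ones, and there the
   tangent line has the entries of gradient F p as coefficients. *)
Definition tangent_lines X : set 'rV[K]_3 :=
  [set l | exists e F p, [/\ curve_equation X e F, X p, gradient F p != 0 &
                             same_point (gradient F p) l]].

Definition dual_curve X := zariski_closure (tangent_lines X).

End PlaneCurves.

Section Parametrizations.
Variable K : fieldType.
Implicit Types (f : 3.-tuple {mpoly K[2]}) (u v : 'rV[K]_2) (p : 'rV[K]_3).

Definition param_eval f u : 'rV[K]_3 := \row_i (tnth f i).@[u 0].

Definition param_fiber f p : set 'rV[K]_2 :=
  [set u : 'rV[K]_2 | u != 0 /\ same_point (param_eval f u) p].

Definition param_image f : set 'rV[K]_3 :=
  [set p : 'rV[K]_3 | p != 0 /\ param_fiber f p !=set0].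

Definition single_point (S : set 'rV[K]_2) :=
  exists2 u, u != 0 & S = [set v | same_point u v].

(* Generically 1-to-1 parametrization of X by coprime forms of degree d. *)
Definition generic_1to1_param (d : nat) f (X : set 'rV[K]_3) :=
  [/\ forall i, tnth f i \is d.-homog,
      is_gcd 1 f,
      param_image f = X &
      generically X (fun p => single_point (param_fiber f p))].

(* The variables s and t are 'X_0 and 'X_1. *)
Definition jacobian_minor (g h : {mpoly K[2]}) : {mpoly K[2]} :=
  g^`M(0) * h^`M(1) - h^`M(0) * g^`M(1).

End Parametrizations.

(* Main.v *)
Require Import Defs.
From HB Require Import structures.
From mathcomp Require Import all_boot all_order all_algebra perm.
From mathcomp Require Import classical_sets reals boolp.
From mathcomp Require Import mpoly.
From mathcomp Require Import complex.
From mathcomp Require Import ring.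

(** Write f_s, f_t for the two partial derivatives of the triple f and fv for
    the triple of reduced minors, so that the cross product of f_s and f_t is
    A fv.

    Why fv parametrizes the dual curve.  Let F be an equation of the curve.
    Differentiating F(f) = 0 shows that the gradient of F at f is orthogonal to
    f_s and f_t, hence proportional to their cross product, that is, to fv
    ([gradient_dual]).  So the tangent line at a smooth point f(u) is the point
    fv(u), and the gradient of F vanishes at f(u) for finitely many points u
    only; taking closures, the dual curve is the image of fv, which is closed
    ([dual_curve_param]).

    Why fv is generically injective.  Euler's identity gives f . fv = 0, and
    fv . f_s = fv . f_t = 0; differentiating, f . fv_s = f . fv_t = 0.  Let H be
    a nonzero form of least degree with H(fv) = 0.  The gradient of H at fv is
    not identically zero and, as before, is orthogonal to fv_s and fv_t, so it
    is proportional to f ([gradient_bidual]).  Thus fv(u) determines f(u), which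
    determines u for generic u ([dual_injective_off]).  This needs fv to be
    nonconstant: otherwise the curve would lie on a line, while its equation has
    degree at least 2 ([dual_degree_gt0]).

    Why the degree of fv is that of the dual curve.  A generically injective
    triple f of forms of degree d without common zero has as its image a curve
    whose ideal is generated by a form of degree d ([param_curve_equation]); this
    is applied to f and to fv.  Let q be a point off the image, with coordinates
    chosen so that q = (0 : 0 : 1); then f_0 and f_1 have no common zero.  By
    Sylvester's dimension count, multiplication by f_2 on the forms of degree
    d - 1 can be written v |-> (f_0 A + f_1 B) v with constant d x d matrices A
    and B ([companion_matrices]).  So the form det (z - x A - y B) of degree d
    vanishes on the image; it does not vanish at q.  It divides every form G
    vanishing on the image: the remainder of the division of G by it, as
    polynomials in z, has degree less than d in z, but for generic (x, y) it has
    d distinct roots, hence is zero, because d points of the curve lie on a generic line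
    through q ([pencil_zeros], [companion_form_dvd]).  As q is an arbitrary point
    off the image, the image is exactly the zero locus of its equation. *)

Set Implicit Arguments.
Unset Strict Implicit.
Unset Printing Implicit Defensive.
Import GRing.Theory Num.Theory.
Local Open Scope ring_scope.

(** * Points in coordinates *)

Section Coordinates.

Lemma ord2 (j : 'I_2) : j = 0 \/ j = 1.
Proof. by case: j => [[|[|]]] // lt_j; [left|right]; apply: val_inj. Qed.

Lemma ord3 (i : 'I_3) : [\/ i = 0, i = 1 | i = ord_max].
Proof.
by case: i => [[|[|[|]]]] // lt_i; [apply: Or31|apply: Or32|apply: Or33]; apply: val_inj.
Qed.

Variable R : nzRingType.

Lemma row_neq0 n (p : 'rV[R]_n) : p != 0 -> exists i, p 0 i != 0.
Proof.
move=> p0; apply: contrapT => nex; case/eqP: p0; apply/rowP => i; rewrite mxE.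
by apply: contrapT => /eqP pi; case: nex; exists i.
Qed.

Lemma ones_neq0 n : const_mx 1 != 0 :> 'rV[R]_n.+1.
Proof. by apply/eqP => /rowP/(_ 0); rewrite !mxE; apply/eqP; rewrite oner_eq0. Qed.

Lemma row2P (u v : 'rV[R]_2) : u 0 0 = v 0 0 -> u 0 1 = v 0 1 -> u = v.
Proof.
by move=> e0 e1; apply/rowP; case=> [[|[|i]]] // lt_i;
  [move: e0|move: e1]; congr (u 0 _ = v 0 _); apply: val_inj.
Qed.

Lemma neq0_row2 (u : 'rV[R]_2) : u != 0 -> u 0 0 != 0 \/ u 0 1 != 0.
Proof.
move=> u0; case: (eqVneq (u 0 0) 0) => [e0|]; last by left.
right; apply: contraNneq u0 => e1; apply/eqP/row2P; rewrite mxE //.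
Qed.

End Coordinates.

Section SamePoint.
Variable K : fieldType.

Lemma same_point_sym n (p q : 'rV[K]_n) : same_point p q -> same_point q p.
Proof. by case=> c c0 ->; exists c^-1; rewrite ?invr_eq0 // scalerA mulVf ?scale1r. Qed.

Lemma same_point_trans n (p q r : 'rV[K]_n) :
  same_point p q -> same_point q r -> same_point p r.
Proof.
by case=> c c0 -> [b b0 ->]; exists (b * c); rewrite ?mulf_neq0 // scalerA.
Qed.

End SamePoint.

(** * Forms and their derivatives *)

Section Homogeneous.
Variables (R : comNzRingType) (n : nat).
Implicit Types (p q : {mpoly R[n]}) (u : 'rV[R]_n).

Lemma meval_homog k p (c : R) u :
  p \is k.-homog -> p.@[(c *: u) 0] = c ^+ k * p.@[u 0].
Proof.
move=> /dhomogP hp; rewrite !mevalE mulr_sumr [LHS]big_seq [RHS]big_seq.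
apply: eq_bigr => m /hp <- /=; rewrite mdegE -prodrXr mulrCA -big_split /=.
by congr (_ * _); apply: eq_bigr => i _; rewrite mxE exprMn.
Qed.

(** Products of powers of forms are how monomials are evaluated at forms. *)
Lemma dhomog_prodX (I : Type) (r : seq I) (F : I -> {mpoly R[n]}) (m : I -> nat) d :
  (forall i, F i \is d.-homog) ->
  \prod_(i <- r) F i ^+ m i \is (d * \sum_(i <- r) m i).-homog.
Proof.
move=> hF; elim: r => [|i r IHr]; first by rewrite !big_nil muln0 dhomog1.
by rewrite !big_cons mulnDr; apply: dhomogM IHr; apply: dhomogMn.
Qed.

Lemma mderiv_homog k p i : p \is k.-homog -> p^`M(i) \is k.-1.-homog.
Proof.
move=> hp; apply/dhomogP => m; rewrite mcoeff_msupp mcoeff_mderiv => nz.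
have : p@_(m + U_(i)) != 0 by apply: contraNneq nz => ->; rewrite mul0rn.
by rewrite -mcoeff_msupp => /(dhomog_mf hp); rewrite /= mdegD mdeg1 addn1 => <-.
Qed.

(** Euler's identity; it holds monomial by monomial. *)
Lemma euler_homog k p :
  p \is k.-homog -> \sum_i 'X_i * p^`M(i) = p *+ k.
Proof.
move=> /dhomogP hp; rewrite {2}[p]mpolyE -sumrMnl.
under eq_bigr do rewrite [X in X^`M(_)]mpolyE raddf_sum /= mulr_sumr.
rewrite exchange_big /= [LHS]big_seq [RHS]big_seq; apply: eq_bigr => m /hp <- /=.
rewrite mdegE -sumrMnr; apply: eq_bigr => i _.
rewrite mderivZ mderivX -scalerAr -scalerAr -mpolyXD scaler_nat -scalerMnr.
case: (posnP (m i)) => [->|mi]; first by rewrite !mulr0n.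
by congr (_ *: 'X_[_] *+ _); rewrite addmC submK // lep1mP -lt0n.
Qed.

End Homogeneous.

Section Chain.

(** The chain rule, for a derivation D of any ring receiving the polynomials: both
    partial derivatives of a composition and derivatives along a line are
    instances. *)
Lemma derivation_mmap (R S : comNzRingType) n (f : {rmorphism R -> S})
    (h : 'I_n -> S) (D : {additive S -> S}) (p : {mpoly R[n]}) :
    (forall x y, D (x * y) = D x * y + x * D y) -> (forall c, D (f c) = 0) ->
  D (mmap f h p) = \sum_i mmap f h (p^`M(i)) * D (h i).
Proof.
move=> DM Df; pose P p := D (mmap f h p) = \sum_i mmap f h (p^`M(i)) * D (h i).
have D1 : D 1 = 0 by rewrite -(rmorph1 f).
have P1 : P 1.
  rewrite /P rmorph1 D1 big1 // => i _.
  by rewrite -mpolyC1 mderivC raddf0 mul0r.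
have PM p1 p2 : P p1 -> P p2 -> P (p1 * p2).
  rewrite /P => H1 H2; rewrite rmorphM DM H1 H2 mulr_suml mulr_sumr -big_split /=.
  by apply: eq_bigr => i _; rewrite mderivM raddfD /= !rmorphM /=; ring.
have PX i : P 'X_i.
  rewrite /P mmapX mmap1U (bigD1 i) //= big1 ?addr0 => [|j ji].
    rewrite mderivX mnm1E eqxx scale1r.
    have -> : (U_(i) - U_(i))%MM = 0%MM :> 'X_{1..n} by apply/mnmP=> j; rewrite mnmBE mnm0E subnn.
    by rewrite mpolyX0 rmorph1 mul1r.
  by rewrite mderivX mnm1E eq_sym (negPf ji) scale0r raddf0 mul0r.
have PXn i k : P ('X_i ^+ k).
  by elim: k => [|k IHk]; rewrite ?expr0 // exprS; apply: PM.
elim/mpolyind: p => [|c m p _ _ IHp].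
  rewrite raddf0 raddf0 big1 // => i _.
  by rewrite mderiv0 raddf0 mul0r.
have Pm : P 'X_[m] by rewrite mpolyXE_id; apply: big_ind.
rewrite raddfD raddfD /= IHp mmapZ DM Df mul0r add0r Pm mulr_sumr -big_split /=.
by apply: eq_bigr => i _; rewrite mderivD mderivZ raddfD /= mmapZ mulrDl mulrA.
Qed.

Lemma mderiv_comp (R : comNzRingType) n k (lq : n.-tuple {mpoly R[k]})
    (p : {mpoly R[n]}) j :
  (p \mPo lq)^`M(j) = \sum_i (p^`M(i) \mPo lq) * (tnth lq i)^`M(j).
Proof.
have := @derivation_mmap R {mpoly R[k]} n (@mpolyC k R) (tnth lq) (mderiv j) p.
apply=> [x y|c]; [exact: mderivM|exact: mderivC].
Qed.

Lemma comp_mpoly_homog (R : comNzRingType) n k d e (lq : n.-tuple {mpoly R[k]})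
    (p : {mpoly R[n]}) :
    p \is e.-homog -> (forall i, tnth lq i \is d.-homog) ->
  p \mPo lq \is (d * e).-homog.
Proof.
move=> /dhomogP hp hl; rewrite comp_mpolyE big_seq; apply: rpred_sum => m /hp <- /=.
by apply: rpredZ; rewrite mdegE; apply: dhomog_prodX.
Qed.
End Chain.

(** * Polynomials in the last variable *)

Section Univariate.
Variables (R : comNzRingType) (n : nat).
Local Notation widen := (widen_ord (leqnSn n)).

Lemma mmultiE (P : {poly {mpoly R[n]}}) :
  mmulti P = (map_poly (@mwiden n R) P).['X_ord_max].
Proof.
rewrite /mmulti (@horner_coef_wide _ (size P)) ?size_poly //.
by apply: eq_bigr => i _; rewrite coef_map.
Qed.

Lemma mmultiD : {morph @mmulti n R : P Q / P + Q}.
Proof. by move=> P Q; rewrite !mmultiE raddfD hornerD. Qed.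

Lemma mmultiM : {morph @mmulti n R : P Q / P * Q}.
Proof. by move=> P Q; rewrite !mmultiE rmorphM hornerM. Qed.

(** Polynomials in n + 1 variables are polynomials in the last one: Euclidean
    division by a monic divisor becomes available. *)
Lemma muniK : cancel (@muni n R) (@mmulti n R).
Proof.
move=> p; elim/mpolyind: p => [|c m p _ _ IHp].
  by rewrite muni0 mmultiE raddf0 horner0.
rewrite [muni _]muniD [LHS]mmultiD; congr (_ + _); last exact: IHp.
rewrite muniZ muniE msuppX big_seq1 mcoeffX eqxx scale1r mmultiE.
rewrite -!mul_polyC !rmorphM /= !map_polyC map_polyXn /= mwidenC mwidenX.
rewrite hornerM hornerC hornerM hornerC hornerXn mpolyXn -mpolyXD mul_mpolyC.
congr (_ *: 'X_[_]); apply/mnmP => i; rewrite mnmDE mulmnE mnm1E.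
case: (unliftP ord_max i) => [j ->|->]; last first.
  by rewrite mnmwiden_ordmax add0n eqxx mul1n.
have -> : lift ord_max j = widen j.
  by apply: val_inj; rewrite /= /bump leqNgt ltn_ord add0n.
rewrite mnmwiden_widen mnmE.
have -> : (ord_max == widen j) = false.
  by apply: gtn_eqF; rewrite /= ltn_ord.
by rewrite mul0n addn0.
Qed.

Lemma meval_mwiden (v : 'I_n.+1 -> R) (p : {mpoly R[n]}) :
  (mwiden p).@[v] = p.@[v \o widen].
Proof.
elim/mpolyind: p => [|c m p _ _ IHp]; first by rewrite mwiden0 !meval0.
rewrite mwidenD !mevalD IHp mwidenZ !mevalZ mwidenX !mevalX; congr (_ * _ + _).
rewrite big_ord_recr /= mnmwiden_ordmax mulr1.
by apply: eq_bigr => i _; rewrite mnmwiden_widen.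
Qed.

Lemma meval_mmulti (v : 'I_n.+1 -> R) (P : {poly {mpoly R[n]}}) :
  (mmulti P).@[v] = (map_poly (meval (v \o widen)) P).[v ord_max].
Proof.
rewrite (@horner_coef_wide _ (size P)) ?size_poly // /mmulti raddf_sum /=.
apply: eq_bigr => i _; rewrite mevalM meval_mwiden rmorphXn /= mevalXU.
by rewrite coef_map.
Qed.
End Univariate.

(** * Density of nonempty open sets *)

Section Density.
Variable K : numFieldType.

Lemma poly_nonroot (p : {poly K}) : p != 0 -> exists x, p.[x] != 0.
Proof.
move=> p0; have := @max_poly_roots _ p [seq i%:R | i <- iota 0 (size p)] p0.
rewrite map_inj_uniq ?iota_uniq; last by move=> i j /eqP; rewrite eqr_nat => /eqP.
rewrite size_map size_iota ltnn => H.
have /allPn[x _ hx] : ~~ all (root p) [seq i%:R | i <- iota 0 (size p)].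
  by apply/negP => /H/(_ isT).
by exists x.
Qed.

(** Induction on the number of variables: first keep the leading coefficient in
    the last variable from vanishing, then choose the last coordinate. *)
Lemma mpoly_nonroot n (p : {mpoly K[n]}) : p != 0 -> exists u : 'rV[K]_n, p.@[u 0] != 0.
Proof.
elim: n p => [|n IHn] p p0.
  exists 0; rewrite (nvar0_mpolyC p) mevalC.
  by apply: contraNneq p0 => p0; rewrite (nvar0_mpolyC p) p0 mpolyC0.
have mp0 : muni p != 0.
  by apply: contraNneq p0 => mp0; rewrite -(muniK p) mp0 mmultiE raddf0 horner0.
have /IHn[u hu] : lead_coef (muni p) != 0 by rewrite lead_coef_eq0.
have : map_poly (meval (u 0)) (muni p) != 0.
  apply/eqP=> /polyP/(_ (size (muni p)).-1); rewrite coef_map coef0 -lead_coefE.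
  exact/eqP.
case/poly_nonroot => x hx; exists (\row_i (if unlift ord_max i is Some j then u 0 j else x)).
rewrite -(muniK p) meval_mmulti mxE unlift_none.
rewrite (@eq_map_poly _ _ _ (meval (u 0))) // => q; apply: meval_eq => j /=.
rewrite mxE.
have -> : widen_ord (leqnSn n) j = lift ord_max j.
  by apply: val_inj; rewrite /= /bump leqNgt ltn_ord add0n.
by rewrite liftK.
Qed.

(** A nonempty open set is dense: the product of g and p vanishes everywhere. *)
Lemma meval_density n (g p : {mpoly K[n]}) : g != 0 ->
  (forall u : 'rV[K]_n, g.@[u 0] != 0 -> p.@[u 0] = 0) -> p = 0.
Proof.
move=> g0 H; apply/eqP; apply: contraTT isT => p0.
have [u] := mpoly_nonroot (mulf_neq0 g0 p0).
by rewrite mevalM mulf_eq0 negb_or => /andP[/H ->]; rewrite eqxx.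
Qed.

(** The same with the origin removed, for use with homogeneous coordinates. *)
Lemma meval_density_proj n (g p : {mpoly K[n.+1]}) : g != 0 ->
  (forall u : 'rV[K]_n.+1, u != 0 -> g.@[u 0] != 0 -> p.@[u 0] = 0) -> p = 0.
Proof.
move=> g0 H; apply: (@meval_density _ (g * 'X_ord0)).
  by rewrite mulf_neq0 // -msize_poly_eq0 msizeX.
move=> u; rewrite mevalM mulf_eq0 negb_or mevalXU => /andP[gu u0]; apply: H => //.
by apply: contraNneq u0 => ->; rewrite mxE.
Qed.

Lemma meval_inj n (p q : {mpoly K[n]}) :
  (forall u : 'rV[K]_n, p.@[u 0] = q.@[u 0]) -> p = q.
Proof.
move=> H; apply/eqP; rewrite -subr_eq0; apply/eqP.
apply: (@meval_density _ 1) => [|u _]; first exact: oner_neq0.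
by rewrite mevalB H subrr.
Qed.

Lemma mpoly_nonroot_proj n (g : {mpoly K[n.+1]}) : g != 0 ->
  exists2 u : 'rV[K]_n.+1, u != 0 & g.@[u 0] != 0.
Proof.
move=> g0; apply: contrapT => H; case/eqP: (g0); apply: (meval_density_proj g0).
by move=> u u0 gu; case: H; exists u.
Qed.

End Density.

(** * Divisors of forms *)

Section Factor.
Variables (R : idomainType) (n : nat).
Implicit Types (p q : {mpoly R[n]}).

(** This is p(T x): its coefficients in T are the homogeneous components of p, so
    that homogeneity of p means that it is a monomial in T. *)
Definition graded p : {poly {mpoly R[n]}} :=
  mmap (polyC \o @mpolyC n R) (fun i => 'X_i *: 'X) p.

Lemma coef_graded p k : (graded p)`_k = pihomog mdeg k p.
Proof.
rewrite /graded /mmap coef_sum pihomogE [RHS]big_mkcond; apply: eq_bigr => m _ /=.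
rewrite coefCM /mmap1.
under eq_bigr do rewrite exprZn.
rewrite scaler_prod -mpolyXE_id prodrXr -mdegE coefZ coefXn eq_sym.
by case: eqP => _; rewrite ?mulr1 ?mulr0 // mul_mpolyC.
Qed.

(** In p(T x) q(T x) = T^k p(x) q(x) the right-hand side is a power of T up to a
    scalar, and so are its divisors. *)
Lemma dhomog_factor k p q : p * q != 0 -> p * q \is k.-homog -> exists e, p \is e.-homog.
Proof.
move=> pq0 hpq.
have gpq : graded p * graded q = (p * q) *: 'X^k.
  rewrite -rmorphM; apply/polyP => j; rewrite coef_graded coefZ coefXn.
  case: eqP => [->|/eqP jk]; first by rewrite pihomog_dE // mulr1.
  by rewrite (pihomog_ne0 _ hpq) ?mulr0 // eq_sym.
have : graded p %| ('X - 0%:P) ^+ k.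
  by rewrite subr0 -(dvdpZr _ _ pq0) -gpq dvdp_mulIl.
case/dvdp_exp_XsubCP => a _; rewrite subr0 => /eqpP[[c1 c2] /andP[/= c10 c20] E].
exists a; rewrite (@pihomog_partitionE _ _ mdeg (msize p) p) //.
apply: rpred_sum => j _; case: (eqVneq (j : nat) a) => [->|ja]; first exact: pihomogP.
have /eqP := congr1 (fun P : {poly _} => P`_j) E; rewrite !coefZ coefXn (negPf ja) mulr0.
by rewrite coef_graded mulf_eq0 (negPf c10) /= => /eqP ->; apply: rpred0.
Qed.

End Factor.

Section Eval.
Variable K : fieldType.

Lemma horner_mmap n (h : 'I_n -> {poly K}) (p : {mpoly K[n]}) x :
  (mmap polyC h p).[x] = p.@[fun i => (h i).[x]].
Proof.
rewrite mevalE /mmap horner_sum; apply: eq_bigr => m _.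
rewrite hornerM hornerC horner_prod; congr (_ * _).
by apply: eq_bigr => i _; rewrite horner_exp.
Qed.

Lemma dhomog0P n (p : {mpoly K[n]}) : p \is 0.-homog -> p = (p@_0)%:MP.
Proof.
move=> hp; apply/mpolyP => m; rewrite mcoeffC.
case: (eqVneq m 0%MM) => [->|m0]; first by rewrite mulr1.
by rewrite mulr0 (dhomog_nemf_coeff hp) //= mdeg_eq0.
Qed.

(** Congruence modulo B is compatible with substitution. *)
Lemma mdivides_comp n k (B : {mpoly K[k]}) (a b : n.-tuple {mpoly K[k]}) (p : {mpoly K[n]}) :
  (forall i, mdivides B (tnth a i - tnth b i)) -> mdivides B ((p \mPo a) - (p \mPo b)).
Proof.
move=> hab; pose P (x y : {mpoly K[k]}) := mdivides B (x - y).
have P0 x : P x x by exists 0; rewrite subrr mul0r.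
have PM x y x' y' : P x y -> P x' y' -> P (x * x') (y * y').
  move=> [q1 e1] [q2 e2]; exists (q1 * x' + y * q2).
  by rewrite mulrDl mulrAC -e1 -mulrA -e2; ring.
have PD x y x' y' : P x y -> P x' y' -> P (x + x') (y + y').
  move=> [q1 e1] [q2 e2]; exists (q1 + q2).
  by rewrite mulrDl -e1 -e2; ring.
have PX x y m : P x y -> P (x ^+ m) (y ^+ m).
  by move=> pxy; elim: m => [|m IHm]; rewrite ?expr0 // !exprS; apply: PM.
rewrite -/(P _ _) !comp_mpolyE; apply: (big_ind2 P) => // m _.
have [q e] : P (\prod_i tnth a i ^+ m i) (\prod_i tnth b i ^+ m i).
  by apply: (big_ind2 P) => // i _; exact/PX/hab.
by exists (p@_m *: q); rewrite -scalerBr e scalerAl.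
Qed.

End Eval.

(** * Binary forms *)

Section BinaryForms.
Variable K : numClosedFieldType.
Implicit Types (p q g h : {mpoly K[2]}) (u v w : 'rV[K]_2).

(** The linear form that vanishes exactly at the point u of the projective line. *)
Definition point_form u : {mpoly K[2]} := u 0 1 *: 'X_0 - u 0 0 *: 'X_1.

Lemma meval_point_form u v : (point_form u).@[v 0] = u 0 1 * v 0 0 - u 0 0 * v 0 1.
Proof. by rewrite mevalB !mevalZ !mevalXU. Qed.

Lemma point_form_homog u : point_form u \is 1.-homog.
Proof. by rewrite rpredB // rpredZ // dhomogX /= mdeg1. Qed.

Lemma point_form_self u : (point_form u).@[u 0] = 0.
Proof. by rewrite meval_point_form mulrC subrr. Qed.

Lemma point_form_eq0P u v : u != 0 -> v != 0 ->
  (point_form u).@[v 0] = 0 -> same_point u v.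
Proof.
move=> u0 v0; rewrite meval_point_form => /eqP; rewrite subr_eq0 => /eqP e.
have [u00|u10] := neq0_row2 u0.
  have E : v = (v 0 0 / u 0 0) *: u.
    by apply: row2P; rewrite mxE ?divfK //; apply: (mulfI u00); rewrite -e; field.
  exists (v 0 0 / u 0 0) => //; apply: contraNneq v0 => e0; rewrite E e0 scale0r//.
have E : v = (v 0 1 / u 0 1) *: u.
  by apply: row2P; rewrite mxE ?divfK //; apply: (mulfI u10); rewrite e; field.
by exists (v 0 1 / u 0 1) => //; apply: contraNneq v0 => e0; rewrite E e0 scale0r.
Qed.

Lemma point_form_neq0 u : u != 0 -> point_form u != 0.
Proof.
move=> /neq0_row2 u0; apply/eqP => E0.
have E (v : 'rV[K]_2) := congr1 (meval (v 0)) E0.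
have E01 : u 0 0 = 0 /\ u 0 1 = 0.
  have := E (\row_i (i == 1)%:R); have := E (\row_i (i == 0)%:R).
  rewrite !meval_point_form !meval0 !mxE /= !mulr0 !mulr1 subr0 sub0r.
  by move=> -> /eqP; rewrite oppr_eq0 => /eqP.
by case: u0 => /eqP; case: E01.
Qed.

(** If u_i is nonzero then, modulo the form of the point u, the variables may be
    replaced by multiples of 'X_i: u_i^k h = h(u_i X) is congruent to
    h('X_i u) = 'X_i^k h(u) = 0. *)
Lemma point_form_dvd k h u : h \is k.-homog -> u != 0 -> h.@[u 0] = 0 ->
  mdivides (point_form u) h.
Proof.
move=> hh u0 hu; have [i ui] := row_neq0 u0.
have := @mdivides_comp _ _ _ (point_form u) [tuple u 0 i *: 'X_j | j < 2]
  [tuple u 0 j *: 'X_i | j < 2] h.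
have -> : h \mPo [tuple u 0 i *: 'X_j | j < 2] = u 0 i ^+ k *: h.
  apply: meval_inj => v; rewrite comp_mpoly_meval mevalZ -(meval_homog _ _ hh).
  by apply: meval_eq => j; rewrite tnth_mktuple mevalZ mevalXU mxE.
have -> : h \mPo [tuple u 0 j *: 'X_i | j < 2] = 0.
  apply: meval_inj => v; rewrite comp_mpoly_meval meval0.
  rewrite (@meval_eq _ _ _ ((v 0 i *: u) 0)) ?(meval_homog _ _ hh) ?hu ?mulr0 // => j.
  by rewrite tnth_mktuple mevalZ mevalXU mxE mulrC.
rewrite subr0; case=> [j|q e].
  rewrite !tnth_mktuple.
  have [->|->] := ord2 i; have [->|->] := ord2 j; rewrite ?subrr;
    try (by exists 0; rewrite mul0r).
    by exists (-1); rewrite /point_form; ring.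
  by exists 1; rewrite /point_form; ring.
exists ((u 0 i ^+ k)^-1 *: q); rewrite -scalerAl -e scalerA mulVf ?scale1r //.
exact: expf_neq0.
Qed.

Lemma point_form_factor k h u : h \is k.+1.-homog -> u != 0 -> h.@[u 0] = 0 ->
  exists2 q, q \is k.-homog & h = q * point_form u.
Proof.
move=> hh u0 hu; have [q e] := point_form_dvd hh u0 hu.
case: (eqVneq h 0) => [->|h0]; first by exists 0; rewrite ?mul0r ?rpred0.
exists q => //; rewrite e in hh h0.
have [a qa] := dhomog_factor h0 hh.
have /(dhomog_uniq h0 hh)/eqP := dhomogM qa (point_form_homog u).
by rewrite addn1 eqSS => /eqP ->.
Qed.

(** Algebraic closedness. If h(x, 1) has no root it is a constant, hence h is a
    multiple of the power of the second variable and vanishes at (1 : 0). *)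
Lemma form_has_zero k h : h \is k.+1.-homog -> exists2 u : 'rV[K]_2, u != 0 & h.@[u 0] = 0.
Proof.
move=> hh; pose p := mmap polyC (fun i : 'I_2 => if i == 0 then 'X else 1) h.
pose P x y : 'rV[K]_2 := \row_i if i == 0 then x else y.
have hp x : p.[x] = h.@[P x 1 0].
  rewrite /p horner_mmap; apply: meval_eq => i; rewrite mxE.
  by case: eqP => _; rewrite ?hornerX ?hornerC.
have [/closed_rootP[x /eqP px]|/negPn/size_poly1P[c c0 pc]] := boolP (size p != 1%N).
  exists (P x 1); last by rewrite -hp.
  by apply/eqP => /rowP/(_ 1); rewrite !mxE /=; apply/eqP; rewrite oner_eq0.
have E : h = c *: 'X_1 ^+ k.+1.
  apply/eqP; rewrite -subr_eq0; apply/eqP; apply: (@meval_density _ _ 'X_1).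
    by rewrite -msize_poly_eq0 msizeX.
  move=> v; rewrite mevalXU => v1; rewrite mevalB mevalZ rmorphXn /= mevalXU.
  have -> : v = v 0 1 *: P (v 0 0 / v 0 1) 1.
    by apply: row2P; rewrite !mxE /= ?mulr1 // mulrC divfK.
  rewrite (meval_homog _ _ hh) -hp pc hornerC !mxE /= mulr1.
  by rewrite mulrC subrr.
exists (P 1 0).
  by apply/eqP => /rowP/(_ 0); rewrite !mxE /=; apply/eqP; rewrite oner_eq0.
by rewrite E mevalZ rmorphXn /= mevalXU mxE /= expr0n mulr0.
Qed.

Lemma form0_meval h u : h \is 0.-homog -> h.@[u 0] = 0 -> h = 0.
Proof. by move/dhomog0P=> ->; rewrite mevalC => ->; rewrite mpolyC0. Qed.

(** A form a without common zero with b and dividing b e divides e, which is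
    impossible for degree reasons. Unique factorization is not used: the zeros of
    a are cancelled one at a time. *)
Lemma coprime_forms_mul_eq d k a b c e : 
    a \is d.-homog -> e \is k.-homog -> (k < d)%N ->
    (forall u, u != 0 -> a.@[u 0] = 0 -> b.@[u 0] != 0) ->
  a * c = b * e -> e = 0.
Proof.
elim: d k a e => // d IHd k a e ha he lt_kd ab E.
have [u u0 au] := form_has_zero ha.
have eu : e.@[u 0] = 0.
  have /eqP := congr1 (meval (u 0)) E; rewrite !mevalM au mul0r eq_sym mulf_eq0.
  by rewrite (negPf (ab u u0 au)) => /eqP.
case: k he lt_kd => [he _|k he lt_kd]; first exact: form0_meval he eu.
have [a' ha' Ea] := point_form_factor ha u0 au.
have [e' he' Ee] := point_form_factor he u0 eu.
rewrite Ee (IHd k a' e') ?mul0r // => [v v0 av|].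
  by apply: ab; rewrite // Ea mevalM av mul0r.
by apply: (mulIf (point_form_neq0 u0)); rewrite mulrAC -Ea E Ee mulrA.
Qed.

(** Split off one linear factor at a time. *)
Lemma form_zeros k h : h != 0 -> h \is k.-homog ->
  exists s : seq 'rV[K]_2, {in s, forall u, u != 0} /\
    forall v, v != 0 -> h.@[v 0] = 0 -> exists2 u, u \in s & same_point u v.
Proof.
elim: k h => [|k IHk] h h0 hh.
  by exists [::]; split=> // v v0 /(form0_meval hh) /eqP; rewrite (negPf h0).
have [u u0 hu] := form_has_zero hh.
have [q hq E] := point_form_factor hh u0 hu.
have q0 : q != 0 by apply: contraNneq h0 => q0; rewrite E q0 mul0r.
have [s [s0 hs]] := IHk q q0 hq; exists (u :: s); split=> [v|v v0].
  by rewrite inE => /predU1P[->|/s0].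
rewrite E mevalM => /eqP; rewrite mulf_eq0 => /orP[/eqP/(hs _ v0)[w ws wv]|/eqP uv].
  by exists w => //; rewrite inE ws orbT.
by exists u; [rewrite inE eqxx|apply: point_form_eq0P].
Qed.

(** Splitting off the linear factor of a zero u leaves a form that does not vanish
    at u, because u is simple; so the other zeros differ from u. *)
Lemma form_simple_zeros k h : h \is k.-homog ->
    (forall u, u != 0 -> h.@[u 0] = 0 -> exists i, (h^`M(i)).@[u 0] != 0) ->
  exists s : seq 'rV[K]_2, [/\ size s = k, {in s, forall u, u != 0 /\ h.@[u 0] = 0} &
     pairwise (fun u v => (point_form u).@[v 0] != 0) s].
Proof.
elim: k h => [|k IHk] h hh sm; first by exists [::].
have [u u0 hu] := form_has_zero hh.
have [q hq E] := point_form_factor hh u0 hu.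
have dE i v : (h^`M(i)).@[v 0] = (q^`M(i)).@[v 0] * (point_form u).@[v 0]
    + q.@[v 0] * ((point_form u)^`M(i)).@[v 0].
  by rewrite E mderivM mevalD !mevalM.
have qu : q.@[u 0] != 0.
  have [i hi] := sm u u0 hu; apply: contraNneq hi => qu.
  by rewrite dE qu point_form_self mulr0 mul0r addr0.
have [|s [sz hs pw]] := IHk q hq.
  move=> v v0 qv; have [|i hi] := sm v v0; first by rewrite E mevalM qv mul0r.
  exists i; move: hi; rewrite dE qv mul0r addr0 => nz.
  by apply: contraNneq nz => ->; rewrite mul0r.
exists (u :: s); split=> /=; first by rewrite sz.
  move=> v; rewrite inE => /predU1P[->|/hs[v0 qv]] //; split=> //.
  by rewrite E mevalM qv mul0r.
rewrite pw andbT; apply/allP => v /hs[v0 qv]; apply: contraNneq qu.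
case/(point_form_eq0P u0 v0) => c c0 Ev; move: qv; rewrite Ev (meval_homog _ _ hq).
by move/eqP; rewrite mulf_eq0 expf_eq0 (negPf c0) andbF => /eqP ->.
Qed.

(** In characteristic 0, if 0 were a root of multiplicity m > 0 of p, then it would
    have multiplicity m - 1 in the left-hand side and at least m in the right-hand
    side. *)
Lemma wronskian_eq0 (p q : {poly K}) :
  q.[0] != 0 -> p.[0] = 0 -> q * p^`() = p * q^`() -> p = 0.
Proof.
move=> q0 p0 E; apply/eqP; apply: contraTT isT => pn0.
have [m [r]] := multiplicity_XsubC p 0; rewrite pn0 subr0 /= => r0 Ep.
case: m Ep => [|m] Ep.
  by move: r0; rewrite /root; move: p0; rewrite Ep mulr1 => ->; rewrite eqxx.
have : 'X^m * (q * (r^`() * 'X + r *+ m.+1)) = 'X^m * (r * 'X * q^`()).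
  transitivity (q * p^`()); last by rewrite E Ep exprS; ring.
  by rewrite Ep derivM derivXn /= exprS -[r *+ _]mulr_natr -['X^m *+ _]mulr_natr; ring.
move/mulfI => /(_ (monic_neq0 (monicXn _ m))) /(congr1 (horner_eval 0)).
rewrite /horner_eval !hornerE /= hornerMn.
move/eqP; rewrite mulf_eq0 (negPf q0) mulrn_eq0 /=.
by rewrite /root in r0; rewrite (negPf r0).
Qed.

(** Euler's identity turns the vanishing of the minor into g dh = h dg. Hence
    r = h - c g satisfies g dr = r dg, and with c chosen so that r vanishes at a
    point u where g does not, r vanishes along every line through u. *)
Lemma jacobian_minor_eq0 k g h : g \is k.+1.-homog -> h \is k.+1.-homog -> g != 0 ->
  jacobian_minor g h = 0 -> exists c, h = c *: g.
Proof.
move=> hg hh /mpoly_nonroot[u gu] J; pose c := h.@[u 0] / g.@[u 0]; exists c.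
have := euler_homog hg; have := euler_homog hh; rewrite !big_ord_recl !big_ord0 !addr0.
rewrite (_ : lift ord0 ord0 = 1 :> 'I_2); last exact: val_inj.
move=> Eh Eg; rewrite -[g *+ _]mulr_natr in Eg; rewrite -[h *+ _]mulr_natr in Eh.
have n0 : k.+1%:R != 0 :> {mpoly K[2]} by rewrite -mpolyC_nat mpolyC_eq0 pnatr_eq0.
have E (i : 'I_2) : g * h^`M(i) = h * g^`M(i).
  apply: (mulIf n0); rewrite mulrAC -Eg [RHS]mulrAC -Eh; move: J.
  rewrite /jacobian_minor; case: i => [[|[|i]]] // li.
    rewrite (_ : Ordinal li = 0); last exact: val_inj.
    by move=> J; apply/eqP; rewrite -subr_eq0; apply/eqP;
      rewrite -[RHS](mulr0 (- 'X_1)) -J; ring.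
  rewrite (_ : Ordinal li = 1); last exact: val_inj.
  by move=> J; apply/eqP; rewrite -subr_eq0; apply/eqP;
      rewrite -[RHS](mulr0 ('X_0)) -J; ring.
pose r := h - c *: g.
have Er i : g * r^`M(i) = r * g^`M(i).
  by rewrite mderivB mderivZ mulrBr mulrBl E -scalerAr -scalerAl.
apply/eqP; rewrite -subr_eq0 -/r; apply/eqP/meval_inj => v; rewrite meval0.
pose l i := (u 0 i)%:P + (v 0 i - u 0 i) *: 'X.
have lE p x : (mmap polyC l p).[x] = p.@[(u + x *: (v - u)) 0].
  rewrite horner_mmap; apply: meval_eq => i.
  by rewrite /l !mxE hornerD hornerC hornerZ hornerX mulrC.
have : mmap polyC l r = 0.
  apply: (@wronskian_eq0 _ (mmap polyC l g)); rewrite ?lE ?scale0r ?addr0 //.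
    by rewrite mevalB mevalZ divfK ?subrr.
  have D p : (mmap polyC l p)^`() = \sum_i mmap polyC l (p^`M(i)) * (l i)^`().
    by apply: (@derivation_mmap _ _ _ _ _ (@deriv K)) => [x y|x]; [exact: derivM|exact: derivC].
  rewrite !D !mulr_sumr; apply: eq_bigr => i _.
  by rewrite !mulrA -!rmorphM Er.
by move/(congr1 (horner_eval 1)); rewrite /horner_eval lE horner0 scale1r addrC subrK.
Qed.

End BinaryForms.

(** * Elimination by Sylvester's argument *)

Section Sylvester.
Variables (K : numClosedFieldType) (d : nat) (a0 a1 : {mpoly K[2]}).
Hypotheses (ha0 : a0 \is d.+1.-homog) (ha1 : a1 \is d.+1.-homog).
Local Notation V := (dhomog 2 K d).
Local Notation W := (dhomog 2 K (d + d.+1)).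

Fact sylvester_homog (x : V * V) : val x.1 * a0 + val x.2 * a1 \is (d + d.+1).-homog.
Proof. by apply: rpredD; apply: dhomogM => //; apply: dhomog_is_dhomog. Qed.

(** Its matrix is the Sylvester matrix of a0 and a1. *)
Definition sylvester x : W := DHomog (sylvester_homog x).

Fact sylvester_linear : linear sylvester.
Proof.
move=> c x y; apply: val_inj => /=; rewrite -!mul_mpolyC; ring.
Qed.
HB.instance Definition _ := GRing.isLinear.Build K (V * V)%type W _ sylvester sylvester_linear.

Hypothesis cop : forall u : 'rV[K]_2, u != 0 -> a0.@[u 0] = 0 -> a1.@[u 0] != 0.

(** The map is injective since a0 and a1 have no common zero, and both sides have
    dimension 2 (d + 1). *)
Lemma sylvester_surjective (h : {mpoly K[2]}) :
  h \is (d + d.+1).-homog -> exists x y : V, h = val x * a0 + val y * a1.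
Proof.
move=> hh; have ker0 : lker (linfun sylvester) = 0%VS.
  apply/eqP; rewrite -subv0; apply/subvP => -[x y].
  rewrite memv_ker lfunE => /eqP/(congr1 val) E0.
  have E : val x * a0 + val y * a1 = 0 := E0.
  have hx := dhomog_is_dhomog x; have hy := dhomog_is_dhomog y.
  have y0 : val y = 0.
    apply: (coprime_forms_mul_eq ha0 hy (ltnSn d) cop (c := - val x)).
    by apply/esym/eqP; rewrite mulrN -addr_eq0 addrC mulrC [a1 * _]mulrC E.
  have x0 : val x = 0.
    apply: (coprime_forms_mul_eq ha1 hx (ltnSn d) _ (c := - val y)) => [u u0 e1|].
      by apply/eqP => /(cop u0); rewrite e1 eqxx.
    by rewrite y0 oppr0 mulr0 mulrC; move: E; rewrite y0 mul0r addr0.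
  by rewrite memv0; apply/eqP; congr (_, _); apply: val_inj.
have full : limg (linfun sylvester) = fullv.
  apply/eqP; rewrite eqEdim subvf /= !dimvf.
  have := limg_ker_dim (linfun sylvester) fullv.
  rewrite ker0 capv0 dimv0 add0n => ->; rewrite dimvf /dim /=.
  by rewrite (_ : dim V = 'C(d + 1, d)) // !addn1 !binSn addSn addnS.
have : DHomog hh \in limg (linfun sylvester) by rewrite full memvf.
case/memv_imgP => -[x y] _; rewrite lfunE => /(congr1 val)/= E.
by exists x, y.
Qed.

End Sylvester.

Section Companion.
Variables (K : numClosedFieldType) (d : nat) (g0 g1 g2 : {mpoly K[2]}).
Hypotheses (h0 : g0 \is d.+1.-homog) (h1 : g1 \is d.+1.-homog) (h2 : g2 \is d.+1.-homog).
Hypothesis cop : forall u : 'rV[K]_2, u != 0 -> g0.@[u 0] = 0 -> g1.@[u 0] != 0.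

(** The matrices express multiplication by g2 from the forms of degree d to
    those of degree 2 d + 1, the latter written as g0 x + g1 y. The eigenvector is
    the list of values at u of a basis of the forms of degree d. *)
Lemma companion_matrices : exists A B : 'M[K]_d.+1, forall u : 'rV[K]_2, u != 0 ->
  eigenvalue (g0.@[u 0] *: A + g1.@[u 0] *: B) g2.@[u 0].
Proof.
pose V := dhomog 2 K d.
have dimV : \dim {:V} = d.+1 by rewrite dimvf /dim /= addn1 binSn.
pose e (i : 'I_d.+1) : V := (vbasis {:V})`_i.
have eP (x : V) : exists c : 'I_d.+1 -> K, val x = \sum_i c i *: val (e i).
  exists (fun i => coord (vbasis fullv) (cast_ord (esym dimV) i) x).
  rewrite {1}(coord_vbasis (memvf x)) /= linear_sum /=.
  rewrite (reindex (cast_ord (esym dimV))) /=; last first.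
    by exists (cast_ord dimV) => i _; rewrite ?cast_ordK ?cast_ordKV.
  by apply: eq_bigr.
have H i : exists ab : ('I_d.+1 -> K) * ('I_d.+1 -> K),
   val (e i) * g2 = (\sum_j ab.1 j *: val (e j)) * g0 + (\sum_j ab.2 j *: val (e j)) * g1.
  have [|x [y ->]] := @sylvester_surjective _ _ _ _ h0 h1 cop (val (e i) * g2).
    exact: (dhomogM (dhomog_is_dhomog (e i)) h2).
  by have [a ->] := eP x; have [b ->] := eP y; exists (a, b).
have [ab abE] := fin_all_exists H.
exists (\matrix_(j, i) (ab i).1 j), (\matrix_(j, i) (ab i).2 j) => u u0.
pose v : 'rV[K]_d.+1 := \row_i (val (e i)).@[u 0].
apply/eigenvalueP; exists v.
  apply/rowP => i; rewrite mxE; under eq_bigr do rewrite !mxE mulrDr.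
  rewrite big_split /= !mxE; have := congr1 (meval (u 0)) (abE i).
  rewrite mevalD !mevalM mulrC => ->; rewrite !raddf_sum !mulr_suml /=.
  by congr (_ + _); apply: eq_bigr => j _; rewrite mevalZ; ring.
apply/eqP => /rowP v0.
have [i ui] := row_neq0 u0.
have hX : ('X_i ^+ d : {mpoly K[2]}) \is d.-homog.
  by rewrite -[X in X.-homog]mul1n; apply: dhomogMn; rewrite dhomogX /= mdeg1.
have [c /(congr1 (meval (u 0)))] := eP (DHomog hX); rewrite /= rmorphXn /= mevalXU => E.
move/negP: (expf_neq0 d ui); apply; rewrite E raddf_sum /= big1 // => j _.
by have := v0 j; rewrite !mxE => vj; rewrite mevalZ vj mulr0.
Qed.
End Companion.

(** * The companion form *)

Section Param.
Variable K : numClosedFieldType.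
Implicit Types (f g : 3.-tuple {mpoly K[2]}) (u v : 'rV[K]_2) (p q : 'rV[K]_3).

Lemma meval_param f (G : {mpoly K[3]}) u :
  (G \mPo f).@[u 0] = G.@[(param_eval f u) 0].
Proof. by rewrite comp_mpoly_meval; apply: meval_eq => i; rewrite mxE. Qed.

Lemma comp_eq0P f (G : {mpoly K[3]}) :
  (G \mPo f = 0) <-> (forall u, u != 0 -> G.@[(param_eval f u) 0] = 0).
Proof.
split=> [E u _|H]; first by rewrite -meval_param E meval0.
apply: (@meval_density_proj _ _ 1) => [|u u0 _]; first exact: oner_neq0.
by rewrite meval_param H.
Qed.

Lemma param_eval_homog d f c u : (forall i, tnth f i \is d.-homog) ->
  param_eval f (c *: u) = c ^+ d *: param_eval f u.
Proof. by move=> hf; apply/rowP => i; rewrite !mxE (meval_homog _ _ (hf i)). Qed.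

(** Generic injectivity in terms of one form: the points of the curve where
    injectivity fails lie on the curve G = 0, which does not contain the image. *)
Definition injective_off f (G : {mpoly K[3]}) :=
  [/\ exists e, G \is e.-homog, G \mPo f != 0 &
      forall u v, u != 0 -> v != 0 -> G.@[(param_eval f u) 0] != 0 ->
        same_point (param_eval f u) (param_eval f v) -> same_point u v].

Definition linear_form (A B : K) : {mpoly K[2]} := A *: 'X_0 + B *: 'X_1.

(** The form det (z - x A - y B), built as a characteristic polynomial so that it
    is visibly monic in the last variable z. *)
Definition companion_form d (A B : 'M[K]_d) : {mpoly K[3]} :=
  mmulti (char_poly (\matrix_(i, j) linear_form (A i j) (B i j))).

Lemma linear_form_homog A B : linear_form A B \is 1.-homog.
Proof. by rewrite rpredD // rpredZ // dhomogX /= mdeg1. Qed.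

Lemma mwiden_homog n k (p : {mpoly K[n]}) : p \is k.-homog -> mwiden p \is k.-homog.
Proof.
move=> /dhomogP hp; rewrite /mwiden /mmap big_seq; apply: rpred_sum => m /hp <- /=.
rewrite mul_mpolyC; apply: rpredZ; rewrite /mmap1 mdegE -[(\sum_i _)%N]mul1n.
by apply: dhomog_prodX => i; rewrite dhomogX /= mdeg1.
Qed.

Lemma det_homog n k (M : 'M[{mpoly K[n]}]_k) :
  (forall i j, M i j \is 1.-homog) -> \det M \is k.-homog.
Proof.
move=> hM; rewrite /determinant rpred_sum // => s _; rewrite mulr_sign.
have : \prod_i M i (s i) \is k.-homog.
  have := @dhomog_prodX _ _ _ (index_enum 'I_k) (fun i => M i (s i))
    (fun=> 1%N) 1 (fun i => hM i (s i)).
  by rewrite mul1n sum_nat_const card_ord muln1.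
by case: (odd_perm s) => // h; rewrite rpredN.
Qed.

Lemma companion_form_homog d (A B : 'M[K]_d) : companion_form A B \is d.-homog.
Proof.
rewrite /companion_form mmultiE.
rewrite -[_.[_]]/((horner_eval 'X_ord_max \o map_poly (@mwiden 2 K)) (char_poly _)).
rewrite /char_poly -det_map_mx; apply: det_homog => i j.
rewrite !mxE /= rmorphB /= /horner_eval map_polyC rmorphMn /= map_polyX.
rewrite hornerD hornerN hornerC hornerMn hornerX rpredB //.
  by rewrite rpredMn // dhomogX /= mdeg1.
exact/mwiden_homog/linear_form_homog.
Qed.

Lemma meval_companion_form d (A B : 'M[K]_d) p :
  (companion_form A B).@[p 0] = (char_poly (p 0 0 *: A + p 0 1 *: B)).[p 0 ord_max].
Proof.
rewrite /companion_form meval_mmulti map_char_poly; congr (char_poly _).[_].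
apply/matrixP => i j; rewrite !mxE [LHS]mevalD !mevalZ !mevalXU /=.
by rewrite mulrC [B i j * _]mulrC; congr (p 0 _ * _ + p 0 _ * _); apply: val_inj.
Qed.

(** A characteristic polynomial of the zero matrix has no nonzero root. *)
Lemma companion_form_neq0 d (A B : 'M[K]_d) p :
  p 0 0 = 0 -> p 0 1 = 0 -> p 0 ord_max != 0 -> (companion_form A B).@[p 0] != 0.
Proof.
move=> p0 p1 p2; rewrite meval_companion_form p0 p1 !scale0r addr0.
apply/negP; rewrite -/(root _ _) -eigenvalue_root_char => /eigenvalueP[v].
by rewrite mulmx0 => /esym/eqP; rewrite scaler_eq0 (negPf p2) => /= /eqP ->; rewrite eqxx.
Qed.

End Param.

(** * The ideal of a birationally parametrized curve *)

Section Divisibility.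
Import Pdiv.Ring Pdiv.RingMonic.
Variable K : numClosedFieldType.
Implicit Types (f g : 3.-tuple {mpoly K[2]}) (u v w : 'rV[K]_2) (p q : 'rV[K]_3).

Lemma jacobian_minor_homog d (g h : {mpoly K[2]}) : g \is d.-homog -> h \is d.-homog ->
  jacobian_minor g h \is (d.-1 + d.-1).-homog.
Proof.
by move=> hg hh; apply: rpredB; apply: dhomogM; apply: mderiv_homog.
Qed.

(** Otherwise g and h would be proportional, and so would share a zero. *)
Lemma jacobian_minor_neq0 d (g h : {mpoly K[2]}) : g \is d.+1.-homog -> h \is d.+1.-homog ->
  (forall u, u != 0 -> g.@[u 0] = 0 -> h.@[u 0] != 0) -> jacobian_minor g h != 0.
Proof.
move=> hg hh cop; have [u u0 gu] := form_has_zero hg.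
have [g0|g0] := eqVneq g 0.
  have [v v0 hv] := form_has_zero hh.
  by have := cop v v0; rewrite g0 meval0 hv eqxx => /(_ erefl).
apply/eqP => /(jacobian_minor_eq0 hg hh g0)[c E].
by have := cop u u0 gu; rewrite E mevalZ gu mulr0 eqxx.
Qed.

(** For generic w the member w_1 g0 - w_0 g1 of the pencil has only simple zeros,
    none of them a zero of b. Indeed a multiple zero is a zero of the jacobian
    minor, and each zero of b or of this minor lies on one member only: W
    excludes these finitely many members. *)
Lemma pencil_zeros d (g0 g1 b : {mpoly K[2]}) : g0 \is d.+1.-homog -> g1 \is d.+1.-homog ->
    (forall u, u != 0 -> g0.@[u 0] = 0 -> g1.@[u 0] != 0) ->
    b != 0 -> (exists e, b \is e.-homog) ->
  exists2 W : {mpoly K[2]}, W != 0 & forall w, w != 0 -> W.@[w 0] != 0 ->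
    exists s : seq 'rV[K]_2, [/\ size s = d.+1,
      {in s, forall v, [/\ v != 0, b.@[v 0] != 0 &
          exists2 c, c != 0 & g0.@[v 0] = c * w 0 0 /\ g1.@[v 0] = c * w 0 1]} &
      pairwise (fun u v => (point_form u).@[v 0] != 0) s].
Proof.
move=> hg0 hg1 cop b0 [e hb].
pose J := jacobian_minor g0 g1; have J0 : J != 0 := jacobian_minor_neq0 hg0 hg1 cop.
have hJ : J \is (d + d).-homog := jacobian_minor_homog hg0 hg1.
have [s [s0 hs]] := form_zeros (mulf_neq0 b0 J0) (dhomogM hb hJ).
pose P v : 'rV[K]_2 := \row_i if i == 0 then g0.@[v 0] else g1.@[v 0].
have P0 v : v != 0 -> P v != 0.
  move=> v0; apply/eqP => /rowP Pv; have := Pv 0; have := Pv 1; rewrite !mxE /=.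
  by move=> e1 /(cop v v0); rewrite e1 eqxx.
(* A member of the pencil is given by a point w; it contains u iff w is P u. *)
exists (\prod_(u <- s) point_form (P u)).
  rewrite prodf_seq_neq0; apply/allP => u us /=.
  exact/point_form_neq0/P0/s0.
move=> w w0; rewrite rmorph_prod prodf_seq_neq0 => /allP Ww.
pose h := w 0 1 *: g0 - w 0 0 *: g1.
have hh : h \is d.+1.-homog by rewrite rpredB // rpredZ.
have hP v : h.@[v 0] = - (point_form (P v)).@[w 0].
  by rewrite mevalB !mevalZ meval_point_form !mxE /=; ring.
have bv v : v != 0 -> h.@[v 0] = 0 -> (b * J).@[v 0] != 0.
  move=> v0 hv; apply/eqP => /(hs v v0)[u us [c c0 E]].
  move: hv; rewrite E (meval_homog _ _ hh) hP => /eqP.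
  rewrite mulf_eq0 expf_eq0 (negPf c0) andbF oppr_eq0 /=.
  by have := Ww u us; rewrite /= => /negPf ->.
have [|zs [sz zsP pw]] := form_simple_zeros hh.
  move=> v v0 /(bv v v0); rewrite mevalM mulf_eq0 negb_or => /andP[_ Jv].
  case: (eqVneq (h^`M(0)).@[v 0] 0) => [e0|]; last by exists 0.
  case: (eqVneq (h^`M(1)).@[v 0] 0) => [e1|]; last by exists 1.
  case/negP: Jv; move: e0 e1; rewrite !mderivB !mderivZ !mevalB !mevalZ.
  move=> /eqP; rewrite subr_eq0 => /eqP e0 /eqP; rewrite subr_eq0 => /eqP e1.
  rewrite !mevalM; case: (neq0_row2 w0) => wi; apply/eqP/(mulfI wi); rewrite mulr0 mulrBr.
    by rewrite [X in X - _]mulrCA -e1 [X in _ - X]mulrA -e0; ring.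
  by rewrite [X in X - _]mulrA e0 [X in _ - X]mulrCA e1; ring.
exists zs; split=> // v /zsP[v0 hv]; have := bv v v0 hv.
rewrite mevalM mulf_eq0 negb_or => /andP[bv0 _]; split=> //.
have [|c c0 E] := @point_form_eq0P _ (P v) w (P0 v v0) w0.
  by apply/eqP; rewrite -oppr_eq0 -hP hv.
exists c^-1; rewrite ?invr_eq0 // E !mxE /=.
by rewrite !mulrA mulVf // !mul1r.
Qed.

(** Division with remainder in the last variable. For generic (x, y) the line of
    the points (x : y : z) meets the curve at d + 1 distinct points, which are
    roots of the remainder; this exceeds its degree in z. *)
Lemma companion_form_dvd d g (A B : 'M[K]_d.+1) (G0 G : {mpoly K[3]}) :
    (forall i, tnth g i \is d.+1.-homog) ->
    (forall u, u != 0 -> (tnth g 0).@[u 0] = 0 -> (tnth g 1).@[u 0] != 0) ->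
    injective_off g G0 ->
    companion_form A B \mPo g = 0 ->
    (exists e, G \is e.-homog) -> G \mPo g = 0 ->
  mdivides (companion_form A B) G.
Proof.
move=> hg cop [[e0 hG0] G0g inj] Fg [e hG] Gg.
pose P := char_poly (\matrix_(i, j) linear_form (A i j) (B i j)).
have Pmon : P \is monic := char_poly_monic _.
pose Q := rdivp (muni G) P; pose R := rmodp (muni G) P.
have E : muni G = Q * P + R := rdivp_eq Pmon (muni G).
have GE : G = mmulti Q * companion_form A B + mmulti R.
  by rewrite -[LHS]muniK E mmultiD mmultiM.
have szR : (size R < d.+2)%N.
  by rewrite -(size_char_poly (\matrix_(i, j) linear_form (A i j) (B i j))) ltn_rmodpN0 // monic_neq0.
suff R0 : R = 0.
  by exists (mmulti Q); rewrite {1}GE R0 [mmulti 0]mmultiE raddf0 horner0 addr0.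
have hF := companion_form_homog A B.
have hG0g : exists e, G0 \mPo g \is e.-homog.
  by eexists; apply: comp_mpoly_homog hG0 hg.
have [W W0 WP] := pencil_zeros (hg 0) (hg 1) cop G0g hG0g.
apply/polyP => k; rewrite coef0; apply: (meval_density_proj W0) => w w0 /(WP w w0)[s [sz sP pw]].
pose Rw := map_poly (meval (w 0)) R.
rewrite -[LHS](coef_map (meval (w 0))) -/Rw; suff -> : Rw = 0 by rewrite coef0.
have [i wi] := row_neq0 w0.
pose i3 := widen_ord (leqnSn 2) i.
have i3E v c : (tnth g 0).@[v 0] = c * w 0 0 -> (tnth g 1).@[v 0] = c * w 0 1 ->
    (tnth g i3).@[v 0] = c * w 0 i.
  move=> e1 e2; rewrite /i3; have [->|->] := ord2 i.
  - by rewrite -e1; congr (tnth g _).@[_]; apply: val_inj.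
  by rewrite -e2; congr (tnth g _).@[_]; apply: val_inj.
(* The last coordinate of the point g(v) once scaled to start with w. *)
pose z v := (tnth g ord_max).@[v 0] * w 0 i / (tnth g i3).@[v 0].
have gE v : v \in s -> exists2 c, c != 0 &
    [/\ (tnth g 0).@[v 0] = c * w 0 0, (tnth g 1).@[v 0] = c * w 0 1 &
        (tnth g ord_max).@[v 0] = c * z v].
  case/sP => _ _ [c c0 [e1 e2]]; exists c => //; split=> //.
  by rewrite /z (i3E _ c) //; field; rewrite c0 wi.
have I3 (x y : 'rV[K]_3) : x 0 0 = y 0 0 -> x 0 1 = y 0 1 -> x 0 ord_max = y 0 ord_max -> x = y.
  by move=> a1 a2 a3; apply/rowP; case=> [[|[|[|j]]]] // lt_j;
    [move: a1|move: a2|move: a3]; congr (x 0 _ = y 0 _); apply: val_inj.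
apply/eqP; apply: contraTT isT => Rw0.
have := @max_poly_roots _ Rw (map z s) Rw0.
rewrite size_map sz ltnNge (leq_trans (size_poly _ _)) //; apply.
  apply/allP => _ /mapP[v vs ->]; have [v0 _ _] := sP v vs; have [c c0 [e1 e2 e3]] := gE v vs.
  pose p := c^-1 *: param_eval g v.
  have : (mmulti R).@[p 0] = 0.
    have := congr1 (meval (p 0)) GE.
    rewrite mevalD mevalM (meval_homog _ _ hG) (meval_homog _ _ hF).
    by rewrite !(comp_eq0P _ _).1 // !mulr0 add0r => <-.
  rewrite meval_mmulti !mxE e3 mulKf // => H; apply/eqP; rewrite -[RHS]H; congr _.[_].
  apply: eq_map_poly => x; apply: meval_eq => j /=; rewrite !mxE.
  have [->|->] := ord2 j.
  - rewrite (_ : widen_ord _ _ = 0); last exact: val_inj.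
    by rewrite e1 mulKf.
  - rewrite (_ : widen_ord _ _ = 1); last exact: val_inj.
    by rewrite e2 mulKf.
rewrite uniq_pairwise pairwise_map; move: pw; apply: (@sub_in_pairwise _ (mem s)); last exact/allP.
(* Equal roots come from the same point of the curve, so by injectivity from the
   same parameter. *)
move=> u v us vs /=; apply: contra => /eqP zuv.
have [u0 bu _] := sP u us; have [v0 _ _] := sP v vs.
have [c c0 [e1 e2 e3]] := gE u us; have [c' c'0 [e1' e2' e3']] := gE v vs.
have [||c'' c''0 ->] := inj u v u0 v0; first by rewrite -meval_param.
  exists (c' / c); first by rewrite mulf_neq0 ?invr_eq0.
  by apply: I3; rewrite !mxE ?e1 ?e2 ?e3 ?e1' ?e2' ?e3' ?zuv ; field; rewrite ?c0.
by rewrite meval_point_form !mxE; apply/eqP; ring.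
Qed.

End Divisibility.

(** * Implicit equations *)

Section Implicit.
Variable K : numClosedFieldType.
Implicit Types (f g : 3.-tuple {mpoly K[2]}) (u v w : 'rV[K]_2) (p q : 'rV[K]_3).
Implicit Types (N M : 'M[K]_3) (F G : {mpoly K[3]}).

(** Linear change of coordinates, dual to [subst_param]. *)
Definition subst_form N G := G \mPo [tuple \sum_j N j i *: 'X_j | i < 3].

Definition subst_param N f : 3.-tuple {mpoly K[2]} :=
  [tuple \sum_j N j i *: tnth f j | i < 3].

Lemma meval_subst_form N G p : (subst_form N G).@[p 0] = G.@[(p *m N) 0].
Proof.
rewrite comp_mpoly_meval; apply: meval_eq => i; rewrite tnth_mktuple mxE raddf_sum /=.
by apply: eq_bigr => j _; rewrite mevalZ mevalXU mulrC.
Qed.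

Lemma subst_form_homog N G k : G \is k.-homog -> subst_form N G \is k.-homog.
Proof.
move=> hG; rewrite -[k]mul1n; apply: comp_mpoly_homog hG _ => i.
rewrite tnth_mktuple rpred_sum // => j _.
by rewrite rpredZ // dhomogX /= mdeg1.
Qed.

Lemma param_eval_subst N f u : param_eval (subst_param N f) u = param_eval f u *m N.
Proof.
apply/rowP => i; rewrite !mxE tnth_mktuple raddf_sum /=; apply: eq_bigr => j _.
by rewrite mevalZ !mxE mulrC.
Qed.

Lemma comp_subst N f G : G \mPo subst_param N f = subst_form N G \mPo f.
Proof.
by apply: meval_inj => u; rewrite !meval_param meval_subst_form param_eval_subst.
Qed.

Lemma subst_formK N G : N \in unitmx -> subst_form (invmx N) (subst_form N G) = G.
Proof.
by move=> uN; apply: meval_inj => p; rewrite !meval_subst_form mulmxKV.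
Qed.

Lemma param_image_mem f u : u != 0 -> param_eval f u != 0 ->
  param_image f (param_eval f u).
Proof.
by move=> u0 fu; split=> //; exists u; split=> //; exists 1; rewrite ?oner_neq0 ?scale1r.
Qed.

(** The companion form, after a change of coordinates that moves q to
    (0 : 0 : 1). Only the last clause depends on generic injectivity; the others
    also serve for the dual parametrization before its injectivity is known. *)
Lemma implicit_form d f q :
    (forall i, tnth f i \is d.+1.-homog) ->
    (forall u, u != 0 -> param_eval f u != 0) ->
    q != 0 -> ~ param_image f q ->
  exists F, [/\ F \is d.+1.-homog, F.@[q 0] != 0, F \mPo f = 0 &
    forall G0, injective_off f G0 -> forall G, (exists e, G \is e.-homog) ->
      G \mPo f = 0 -> mdivides F G].
Proof.
move=> hf nz q0 qf; pose e2 : 'rV[K]_3 := delta_mx 0 ord_max.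
have [N uN qN] : exists2 N, N \in unitmx & q *m N = e2.
  have e2q : e2 *m (delta_mx ord_max 0 *m q) = q.
    by rewrite mulmxA mul_delta_mx -rowE; apply/rowP => j; rewrite mxE.
  have [|M uM E] := @complete_unitmx _ _ _ e2 (delta_mx ord_max 0 *m q).
    by rewrite e2q mxrank_delta rank_rV q0.
  exists (invmx M); rewrite ?unitmx_inv //.
  by rewrite -e2q E mulmxK.
pose g := subst_param N f.
have hg i : tnth g i \is d.+1.-homog.
  by rewrite tnth_mktuple rpred_sum // => j _; rewrite rpredZ.
have gE u i : (tnth g i).@[u 0] = (param_eval f u *m N) 0 i.
  by rewrite -param_eval_subst mxE.
have cop u : u != 0 -> (tnth g 0).@[u 0] = 0 -> (tnth g 1).@[u 0] != 0.
  move=> u0; rewrite !gE => g0; apply/eqP => g1; apply: qf.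
  have E : param_eval f u *m N = (param_eval f u *m N) 0 ord_max *: e2.
    apply/rowP; case=> [[|[|[|j]]]] // lt_j; rewrite [RHS]mxE [e2 _ _]mxE /= ?mulr0 ?mulr1.
    - by rewrite -[RHS]g0; congr ((_ *m N) 0 _); apply: val_inj.
    - by rewrite -[RHS]g1; congr ((_ *m N) 0 _); apply: val_inj.
    - by congr ((_ *m N) 0 _); apply: val_inj.
  move: E; move: (_ 0 ord_max) => c E.
  split=> //; exists u; split=> //; apply: same_point_sym; exists c.
    apply: contraNneq (nz u u0) => c0; move: E; rewrite c0 scale0r => E.
    by rewrite -(mulmxK uN (param_eval f u)) E mul0mx.
  by rewrite -[LHS](mulmxK uN) E -scalemxAl -qN mulmxK.
have [A [B AB]] := companion_matrices (hg 0) (hg 1) (hg ord_max) cop.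
have Fg : companion_form A B \mPo g = 0.
  apply/comp_eq0P => u u0; rewrite meval_companion_form !mxE.
  by apply/eqP; rewrite -/(root _ _) -eigenvalue_root_char AB.
exists (subst_form N (companion_form A B)); split.
- exact/subst_form_homog/companion_form_homog.
- by rewrite meval_subst_form qN companion_form_neq0 // !mxE //= oner_eq0.
- by rewrite -comp_subst.
move=> G0 [[k hG0] G0f inj] G [e hG] Gf.
have Mf G1 : subst_form (invmx N) G1 \mPo g = G1 \mPo f.
  rewrite /g comp_subst; congr (_ \mPo f).
  by rewrite -{1}[N]invmxK subst_formK // unitmx_inv.
have [|||Q E] := @companion_form_dvd K d g A B (subst_form (invmx N) G0)
    (subst_form (invmx N) G) hg cop _ Fg.
- split; [by exists k; apply: subst_form_homog|by rewrite Mf|].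
  move=> u v u0 v0; rewrite /g !param_eval_subst meval_subst_form mulmxK // => Gu [c c0 E].
  apply: inj => //; exists c => //.
  by rewrite -[LHS](mulmxK uN) E -scalemxAl mulmxK.
- by exists e; apply: subst_form_homog.
- by rewrite Mf.
exists (subst_form N Q); rewrite -[LHS](@subst_formK (invmx N)) ?unitmx_inv // invmxK E.
exact: rmorphM.
Qed.

Lemma exists_notin (s : seq K) : exists x, x \notin s.
Proof.
have [|x] := @poly_nonroot K (\prod_(y <- s) ('X - y%:P)).
  by rewrite prodf_seq_neq0; apply/allP => y _; rewrite polyXsubC_eq0.
by rewrite -/(root _ _) root_prod_XsubC => ?; exists x.
Qed.

(** The points (0 : 1 : a) of the image come from the finitely many zeros of the
    first coordinate of f. *)
Lemma exists_off_image d f : (forall i, tnth f i \is d.-homog) ->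
  exists2 q, q != 0 & ~ param_image f q.
Proof.
move=> hf; pose P a : 'rV[K]_3 := \row_i nth 0 [:: 0; 1; a] i.
have P0 a : P a != 0.
  by apply/eqP => /rowP/(_ 1); rewrite !mxE /= => /eqP; rewrite oner_eq0.
have [f0|f0] := eqVneq (tnth f 0) 0.
  exists (\row_i (i == 0)%:R).
    by apply/eqP => /rowP/(_ 0); rewrite !mxE /= => /eqP; rewrite oner_eq0.
  case=> _ [u [u0 [c c0 /rowP/(_ 0)]]]; rewrite !mxE f0 meval0 mulr0 /=.
  by move/eqP; rewrite oner_eq0.
have [s [_ sP]] := form_zeros f0 (hf 0).
have [a] := exists_notin [seq (tnth f ord_max).@[u 0] / (tnth f 1).@[u 0] | u : 'rV[K]_2 <- s].
move=> /negP na; exists (P a) => // -[_ [u [u0 [c c0 /rowP Pa]]]]; apply: na.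
have fu : (tnth f 0).@[u 0] = 0.
  by have /esym/eqP := Pa 0; rewrite !mxE /= mulf_eq0 (negPf c0) => /eqP.
have [v vs [b b0 E]] := sP u u0 fu; apply/mapP; exists v => //.
have := Pa 1; have := Pa ord_max; rewrite !mxE /= E !(meval_homog _ _ (hf _)) => -> e1.
have nz : (tnth f 1).@[v 0] != 0.
  by apply: contra_eq_neq e1 => ->; rewrite !mulr0 oner_eq0.
apply: (mulIf nz); rewrite divfK // -[RHS]mul1r e1; ring.
Qed.

(** A point p off the image is not a zero of F, since F divides the form attached
    to p by [implicit_form]. *)
Lemma param_curve_equation d f G0 : 
    (forall i, tnth f i \is d.+1.-homog) ->
    (forall u, u != 0 -> param_eval f u != 0) ->
    injective_off f G0 ->
  exists F, curve_equation (param_image f) d.+1 F.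
Proof.
move=> hf nz inj; have [q q0 qf] := exists_off_image hf.
have [F [hF Fq Ff Fdvd]] := implicit_form hf nz q0 qf.
exists F; split=> //.
- by apply: contraNneq Fq => ->; rewrite meval0.
- apply/seteqP; split=> p.
    move=> [p0 [u [u0 [c c0 E]]]]; split=> // G ->.
    by rewrite E (meval_homog _ _ hF) -meval_param Ff meval0 mulr0.
  move=> [p0 /(_ F erefl) Fp]; apply: contrapT => pf.
  have [F' [hF' F'p F'f _]] := implicit_form hf nz p0 pf.
  have [|Q E] := Fdvd G0 inj F' _ F'f; first by exists d.+1.
  by move: F'p; rewrite E mevalM Fp mulr0 eqxx.
move=> G [[k hG] Gf]; apply: Fdvd inj _ _ _; first by exists k.
apply/comp_eq0P => u u0; apply: Gf; exact/param_image_mem/nz.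
Qed.

Lemma curve_equation_degree (X : set 'rV[K]_3) e e' F F' :
  curve_equation X e F -> curve_equation X e' F' -> e = e'.
Proof.
move=> [e0 F0 hF XF dF] [e0' F0' hF' XF' dF'].
have vF : vanishing_forms X F by split; [exists e|rewrite XF => p [_ /(_ F erefl)]].
have vF' : vanishing_forms X F' by split; [exists e'|rewrite XF' => p [_ /(_ F' erefl)]].
have le k k' G G' : G \is k.-homog -> G' \is k'.-homog -> G' != 0 -> mdivides G G' -> (k <= k')%N.
  move=> hG hG' G'0 [Q E]; rewrite E in hG' G'0.
  have [j hQ] := dhomog_factor G'0 hG'.
  by rewrite -(dhomog_uniq G'0 (dhomogM hQ hG) hG') leq_addl.
by apply/eqP; rewrite eqn_leq (le _ _ _ _ hF hF' F0' (dF _ vF')) (le _ _ _ _ hF' hF F0 (dF' _ vF)).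
Qed.

(** Two equations of a curve divide each other, so they have the same degree. *)
Lemma curve_degreeE (X : set 'rV[K]_3) e F : curve_equation X e F -> curve_degree X = e.
Proof.
move=> XF; rewrite /curve_degree; case: xgetP => [k _ [F' XF']|/(_ e)[]]; last by exists F.
exact: curve_equation_degree XF' XF.
Qed.

End Implicit.

(** * Generic injectivity *)

Section Generic.
Variable K : numClosedFieldType.
Implicit Types (f g : 3.-tuple {mpoly K[2]}) (u v w : 'rV[K]_2) (p q : 'rV[K]_3).
Implicit Types (F G : {mpoly K[3]}).

Lemma injective_off_generically d f G :
    (forall i, tnth f i \is d.-homog) ->
    (forall u, u != 0 -> param_eval f u != 0) ->
    injective_off f G ->
  generically (param_image f) (fun p => single_point (param_fiber f p)).
Proof.
move=> hf nz [[e hG] Gf inj]; exists (zero_locus [set G]%classic); split.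
- apply/seteqP; split=> p [p0 H]; split=> // F;
    last by move=> [_]; apply; split=> // _ ->; apply: H.
  by move=> ->; apply: H; split; [exists e|move=> q [_]; apply].
- move=> p [p0 [u [u0 [c c0 ->]]]]; split; first by rewrite scaler_eq0 negb_or c0 nz.
  move=> F [[k hF] HF]; rewrite (meval_homog _ _ hF) -meval_param.
  suff -> : F \mPo f = 0 by rewrite meval0 mulr0.
  apply: (meval_density_proj Gf) => v v0; rewrite !meval_param => Gv.
  apply: HF; split; first exact/param_image_mem/nz.
  by move=> [_ /(_ G erefl) Gv0]; rewrite Gv0 eqxx in Gv.
move=> p [[p0 [u [u0 [c c0 Ep]]]] pZ]; exists u => //.
have Gu : G.@[(param_eval f u) 0] != 0.
  apply/eqP => Gu; apply: pZ; split=> // _ ->.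
  by rewrite Ep (meval_homog _ _ hG) Gu mulr0.
apply/seteqP; split=> v.
  move=> [v0 fv]; apply: inj => //; apply: same_point_trans (same_point_sym fv).
  by exists c.
move=> [b b0 ->]; split; first by rewrite scaler_eq0 negb_or b0.
rewrite (param_eval_homog _ _ hf) Ep; exists (c / b ^+ d).
  by rewrite mulf_neq0 // invr_eq0 expf_neq0.
by rewrite scalerA divfK // expf_neq0.
Qed.

(** The exceptional closed set Z misses a point of the image, hence so does one of
    the forms that define Z. *)
Lemma generically_injective_off f :
    (forall u, u != 0 -> param_eval f u != 0) ->
    generically (param_image f) (fun p => single_point (param_fiber f p)) ->
  exists G, injective_off f G.
Proof.
move=> nz [Z [Zcl dense single]].
pose u0 : 'rV[K]_2 := const_mx 1; have u0nz : u0 != 0 := ones_neq0 K 1.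
have [p [[p0 [u [unz [c c0 Ep]]]] pZ]] : exists p, (param_image f `\` Z)%classic p.
  apply: contrapT => nex; have [_ H] := dense _ (param_image_mem u0nz (nz _ u0nz)).
  have /eqP : (1 : {mpoly K[3]}).@[(param_eval f u0) 0] = 0.
    apply: H; split; first by exists 0%N; rewrite dhomog1.
    by move=> p Hp; case: nex; exists p.
  by rewrite meval1 oner_eq0.
have [G [[[e hG] GZ] Gp]] : exists G, vanishing_forms Z G /\ G.@[p 0] != 0.
  apply: contrapT => nex; apply: pZ; rewrite -Zcl; split=> // G GZ.
  by apply: contrapT => /eqP Gp; case: nex; exists G.
exists G; split; first by exists e.
  apply: contraNneq Gp => Gf.
  by rewrite Ep (meval_homog _ _ hG) -meval_param Gf meval0 mulr0.
move=> v w v0 w0 Gv vw.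
have [|x x0 E] := single (param_eval f v).
  by split; [exact/param_image_mem/nz|move=> /GZ Gv0; rewrite Gv0 eqxx in Gv].
have xv : same_point x v.
  suff : param_fiber f (param_eval f v) v by rewrite E.
  by split=> //; exists 1; rewrite ?oner_neq0 ?scale1r.
have xw : same_point x w.
  suff : param_fiber f (param_eval f v) w by rewrite E.
  by split=> //; apply: same_point_sym.
exact: same_point_trans (same_point_sym xv) xw.
Qed.

(** The linear form of a common zero would be a common divisor. *)
Lemma gcd1_no_common_zero d f : (forall i, tnth f i \is d.-homog) -> is_gcd 1 f ->
  forall u, u != 0 -> param_eval f u != 0.
Proof.
move=> hf [_ H] u u0; apply/eqP => /rowP fu.
have [|Q /(congr1 (meval (u 0)))] := H (point_form u).
  move=> G /tnthP[i ->]; apply: point_form_dvd (hf i) u0 _.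
  by have := fu i; rewrite !mxE.
by rewrite meval1 mevalM point_form_self mulr0 => /eqP; rewrite oner_eq0.
Qed.

(** For H of least degree the partial derivatives of H cannot vanish on the image
    unless they are zero, and they are not all zero by Euler's identity. *)
Lemma minimal_form d f : (forall i, tnth f i \is d.+1.-homog) ->
    (forall u, u != 0 -> param_eval f u != 0) ->
  exists k H, [/\ H \is k.-homog, H \mPo f = 0 & exists i, H^`M(i) \mPo f != 0].
Proof.
move=> hf nz; have [q q0 qf] := exists_off_image hf.
have [F [hF Fq Ff _]] := implicit_form hf nz q0 qf.
pose P k := `[< exists H, [/\ H \is k.-homog, H != 0 & H \mPo f = 0] >].
have exP : exists k, P k.
  exists d.+1; apply/asboolP; exists F; split=> //.
  by apply: contraNneq Fq => ->; rewrite meval0.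
case: (ex_minnP exP) => k /asboolP[H [hH H0 Hf]] kmin; exists k, H; split=> //.
apply: contrapT => nex.
have k0 : (0 < k)%N.
  rewrite lt0n; apply: contraNneq H0 => k0; move: hH Hf; rewrite k0 => /dhomog0P ->.
  by rewrite comp_mpolyC => /eqP; rewrite mpolyC_eq0 => /eqP ->; rewrite mpolyC0.
have dH i : H^`M(i) = 0.
  apply: contrapT => /eqP Hi; have : P k.-1.
    apply/asboolP; exists H^`M(i); split=> //; first exact: mderiv_homog.
    by apply: contrapT => /eqP Hif; case: nex; exists i.
  by move/kmin; rewrite leqNgt prednK // leqnn.
have /eqP := euler_homog hH; rewrite big1 => [|i _]; last by rewrite dH mulr0.
by rewrite eq_sym -mulr_natr mulf_eq0 (negPf H0) -mpolyC_nat mpolyC_eq0 pnatr_eq0 -leqn0 leqNgt k0.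
Qed.

End Generic.

(** * Cross products *)

Section Cross.
Variable R : idomainType.
Implicit Types a b x y : 'I_3 -> R.

Definition dot x y := \sum_i x i * y i.

Definition cross a b (i : 'I_3) : R :=
  if i == 0 then a 1 * b ord_max - a ord_max * b 1
  else if i == 1 then a ord_max * b 0 - a 0 * b ord_max
  else a 0 * b 1 - a 1 * b 0.

Lemma dotE x y : dot x y = x 0 * y 0 + x 1 * y 1 + x ord_max * y ord_max.
Proof.
rewrite /dot !big_ord_recl big_ord0 addr0 addrA.
by congr (_ + x _ * y _ + x _ * y _); apply: val_inj.
Qed.

Lemma dotC x y : dot x y = dot y x.
Proof. by apply: eq_bigr => i _; rewrite mulrC. Qed.

Lemma crossE a b : [/\ cross a b 0 = a 1 * b ord_max - a ord_max * b 1,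
  cross a b 1 = a ord_max * b 0 - a 0 * b ord_max &
  cross a b ord_max = a 0 * b 1 - a 1 * b 0].
Proof. by []. Qed.

Lemma dot_cross a b : dot (cross a b) a = 0 /\ dot (cross a b) b = 0.
Proof. by rewrite !dotE; have [-> -> ->] := crossE a b; split; ring. Qed.

(** This is x × (a × b) = a (x · b) - b (x · a). *)
Lemma orth_parallel_cross a b x i j : dot x a = 0 -> dot x b = 0 ->
  x i * cross a b j = x j * cross a b i.
Proof.
rewrite !dotE => xa xb; have [e0 e1 e2] := crossE a b.
have E (k : 'I_3) (l r : R) :
    l - r = a k * (x 0 * b 0 + x 1 * b 1 + x ord_max * b ord_max)
          - b k * (x 0 * a 0 + x 1 * a 1 + x ord_max * a ord_max) -> l = r.
  by rewrite xa xb !mulr0 subr0 => /eqP; rewrite subr_eq0 => /eqP.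
have P01 : x 0 * cross a b 1 = x 1 * cross a b 0.
  by apply: (E ord_max); rewrite e0 e1; ring.
have P12 : x 1 * cross a b ord_max = x ord_max * cross a b 1.
  by apply: (E 0); rewrite e1 e2; ring.
have P20 : x ord_max * cross a b 0 = x 0 * cross a b ord_max.
  by apply: (E 1); rewrite e0 e2; ring.
by have [->|->|->] := ord3 i; have [->|->|->] := ord3 j.
Qed.

(** Both are proportional to the nonzero vector a × b. *)
Lemma orth_parallel a b x y : (exists i, cross a b i != 0) ->
    dot x a = 0 -> dot x b = 0 -> dot y a = 0 -> dot y b = 0 ->
  forall i j, x i * y j = x j * y i.
Proof.
move=> [k nk] xa xb ya yb i j; apply: (mulIf (mulf_neq0 nk nk)).
have E z : dot z a = 0 -> dot z b = 0 -> forall i, z i * cross a b k = z k * cross a b i.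
  by move=> za zb l; apply: orth_parallel_cross.
rewrite [LHS]mulrACA (E x) // (E y) // [RHS]mulrACA (E x) // (E y) //.
by rewrite mulrACA [RHS]mulrACA [cross a b i * _]mulrC.
Qed.

End Cross.

(** * Tangent lines and biduality *)

Section Tangents.
Variable K : numClosedFieldType.
Implicit Types (f g : 3.-tuple {mpoly K[2]}) (u v w : 'rV[K]_2) (p q : 'rV[K]_3).
Implicit Types (F G : {mpoly K[3]}).

Definition param_deriv f (j : 'I_2) (i : 'I_3) : {mpoly K[2]} := (tnth f i)^`M(j).

Definition grad_comp F f (i : 'I_3) : {mpoly K[2]} := F^`M(i) \mPo f.

Definition jacobian_cross f := cross (param_deriv f 0) (param_deriv f 1).

(** Differentiating F(f) = 0. *)
Lemma dot_grad_comp F f j : F \mPo f = 0 -> dot (grad_comp F f) (param_deriv f j) = 0.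
Proof. by move=> Ff; rewrite -[RHS](mderiv0 _ j) -Ff mderiv_comp. Qed.

Lemma meval_grad_comp F f u i : (grad_comp F f i).@[u 0] = gradient F (param_eval f u) 0 i.
Proof. by rewrite meval_param mxE. Qed.

(** If all minors vanish then all coordinates of f are multiples of a single one,
    whose zeros are common zeros. *)
Lemma jacobian_cross_neq0 d f : (forall i, tnth f i \is d.+1.-homog) ->
    (forall u, u != 0 -> param_eval f u != 0) ->
  exists i, jacobian_cross f i != 0.
Proof.
move=> hf nz; apply: contrapT => nex.
have J0 i : jacobian_cross f i = 0 by apply: contrapT => /eqP; move=> Ji; case: nex; exists i.
have [e0 e1 e2] := crossE (param_deriv f 0) (param_deriv f 1).
have anti (g h : {mpoly K[2]}) : jacobian_minor g h = - jacobian_minor h g.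
  by rewrite /jacobian_minor opprB.
have J01 : jacobian_minor (tnth f 0) (tnth f 1) = 0 := J0 ord_max.
have J12 : jacobian_minor (tnth f 1) (tnth f ord_max) = 0 := etrans (esym e0) (J0 0).
have J20 : jacobian_minor (tnth f ord_max) (tnth f 0) = 0 := etrans (esym e1) (J0 1).
have Jd (g : {mpoly K[2]}) : jacobian_minor g g = 0 by rewrite /jacobian_minor subrr.
have J i j : jacobian_minor (tnth f i) (tnth f j) = 0.
  have [->|->|->] := ord3 i; have [->|->|->] := ord3 j; rewrite ?Jd ?J01 ?J12 ?J20 //;
    by rewrite anti ?J01 ?J12 ?J20 oppr0.
have [k fk] := row_neq0 (nz _ (ones_neq0 K 1)).
have fk0 : tnth f k != 0 by apply: contraNneq fk => fk0; rewrite mxE fk0 meval0.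
have [u u0 fku] := form_has_zero (hf k).
case/eqP: (nz u u0); apply/rowP => i; rewrite !mxE.
have [c ->] := jacobian_minor_eq0 (hf k) (hf i) fk0 (J k i).
by rewrite mevalZ fku mulr0.
Qed.

Lemma parallel_meval (x y : 'I_3 -> {mpoly K[2]}) u :
    (forall i j, x i * y j = x j * y i) -> (exists i, (y i).@[u 0] != 0) ->
  exists c, forall i, (x i).@[u 0] = c * (y i).@[u 0].
Proof.
move=> xy [k yk]; exists ((x k).@[u 0] / (y k).@[u 0]) => i.
by apply: (mulIf yk); rewrite mulrAC divfK // -!mevalM xy.
Qed.

Lemma param_euler d f i : tnth f i \is d.-homog ->
  tnth f i *+ d = 'X_0 * param_deriv f 0 i + 'X_1 * param_deriv f 1 i.
Proof.
move=> /euler_homog <-; rewrite !big_ord_recl big_ord0 addr0.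
by rewrite (_ : lift ord0 ord0 = 1) //; apply: val_inj.
Qed.

Section Duality.
Variables (d n : nat) (f fv : 3.-tuple {mpoly K[2]}) (A : {mpoly K[2]}).
Hypotheses (hf : forall i, tnth f i \is d.+1.-homog)
           (nzf : forall u, u != 0 -> param_eval f u != 0)
           (hfv : forall i, tnth fv i \is n.-homog)
           (nzfv : forall u, u != 0 -> param_eval fv u != 0)
           (A0 : A != 0)
           (fvE : forall i, jacobian_cross f i = tnth fv i * A).

Lemma dot_dual_deriv j : dot (tnth fv) (param_deriv f j) = 0.
Proof.
apply: (mulIf A0); rewrite mul0r /dot mulr_suml.
under eq_bigr do rewrite mulrAC -fvE.
by have [e0 e1] := dot_cross (param_deriv f 0) (param_deriv f 1); have [->|->] := ord2 j.
Qed.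

(** Euler's identity expresses f through its derivatives. *)
Lemma dot_dual : dot (tnth f) (tnth fv) = 0.
Proof.
have n0 : d.+1%:R != 0 :> {mpoly K[2]} by rewrite -mpolyC_nat mpolyC_eq0 pnatr_eq0.
apply: (mulfI n0); rewrite mulr0 /dot mulr_sumr.
under eq_bigr do rewrite mulrA mulr_natl (param_euler (hf _)) mulrDl -!mulrA.
rewrite big_split /= -!mulr_sumr.
by rewrite -!/(dot _ _) !(dotC _ (tnth fv)) !dot_dual_deriv !mulr0 addr0.
Qed.

Lemma dot_deriv_dual j : dot (tnth f) (param_deriv fv j) = 0.
Proof.
have := congr1 (mderiv j) dot_dual; rewrite /dot raddf_sum mderiv0 /=.
under eq_bigr do rewrite mderivM.
by rewrite big_split /= -!/(dot _ _) [X in X + _]dotC dot_dual_deriv add0r.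
Qed.

(** Both sides are orthogonal to the two derivatives of f. In geometric terms, the
    tangent line at a smooth point f(u) is the point fv(u). *)
Lemma gradient_dual F u : F \mPo f = 0 -> u != 0 ->
  exists c, gradient F (param_eval f u) = c *: param_eval fv u.
Proof.
move=> Ff u0; have [i fvi] := row_neq0 (nzfv u0).
have [||c cE] := @parallel_meval (grad_comp F f) (tnth fv) u.
- apply: (@orth_parallel _ (param_deriv f 0) (param_deriv f 1)); rewrite ?dot_grad_comp ?dot_dual_deriv //.
  exact: jacobian_cross_neq0 hf nzf.
- by exists i; move: fvi; rewrite mxE.
by exists c; apply/rowP => k; rewrite -meval_grad_comp cE !mxE.
Qed.

(** Biduality: the roles of f and fv may be exchanged, as f is orthogonal to the
    derivatives of fv, and the tangent line to the dual curve at fv(u) is f(u). *)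
Lemma gradient_bidual F u : (0 < n)%N -> F \mPo fv = 0 -> u != 0 ->
  exists c, gradient F (param_eval fv u) = c *: param_eval f u.
Proof.
move=> n0 Ff u0; have [i fi] := row_neq0 (nzf u0).
have [||c cE] := @parallel_meval (grad_comp F fv) (tnth f) u.
- apply: (@orth_parallel _ (param_deriv fv 0) (param_deriv fv 1)); rewrite ?dot_grad_comp ?dot_deriv_dual //.
  by apply: (@jacobian_cross_neq0 n.-1); rewrite ?prednK.
- by exists i; move: fi; rewrite mxE.
by exists c; apply/rowP => k; rewrite -meval_grad_comp cE !mxE.
Qed.

Variable G0 : {mpoly K[3]}.
Hypotheses (inj : injective_off f G0) (d0 : (0 < d)%N).

(** A constant fv is the vector of coefficients of a line containing the curve, but
    the equation of the curve has degree at least 2. *)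
Lemma dual_degree_gt0 : (0 < n)%N.
Proof.
rewrite lt0n; apply/eqP => n0.
have [F [_ _ hF _ dF]] := param_curve_equation hf nzf inj.
have cfv i : tnth fv i = ((tnth fv i)@_0)%:MP by apply: dhomog0P; have := hfv i; rewrite n0.
pose a : {mpoly K[3]} := \sum_i (tnth fv i)@_0 *: 'X_i.
have ha : a \is 1.-homog by rewrite rpred_sum // => i _; rewrite rpredZ // dhomogX /= mdeg1.
have af : a \mPo f = 0.
  rewrite -dot_dual dotC /dot raddf_sum; apply: eq_bigr => i _ /=.
  by rewrite comp_mpolyZ comp_mpolyXU -tnth_nth {2}cfv mul_mpolyC.
have a0 : a != 0.
  have [i ai] := row_neq0 (nzfv (ones_neq0 K 1)); move: ai.
  rewrite mxE cfv mevalC; apply: contraNneq => /(congr1 (mcoeff U_(i))).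
  rewrite mcoeff0 raddf_sum (bigD1 i) //= big1 => [|j ji]; rewrite mcoeffZ mcoeffXU.
    by rewrite eqxx mulr1 addr0 => ->.
  by rewrite (negPf ji) mulr0.
have [|Q E] := dF a.
  split; first by exists 1%N.
  move=> p [p0 [u [u0 [c c0 ->]]]].
  by rewrite (meval_homog _ _ ha) -meval_param af meval0 mulr0.
rewrite E in ha a0; have [j hQ] := dhomog_factor a0 ha.
have := dhomog_uniq a0 (dhomogM hQ hF) ha; case: (d) d0 => // d' _.
by rewrite !addnS.
Qed.

(** The gradient of a form H of least degree vanishing on fv recovers f(u) from
    fv(u), as long as it is nonzero; G0 then ensures that f(u) determines u. *)
Lemma dual_injective_off : exists W, injective_off fv W.
Proof.
have n0 := dual_degree_gt0; have hfv' i : tnth fv i \is n.-1.+1.-homog by rewrite prednK.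
have [k [H [hH Hfv [i Hi]]]] := minimal_form hfv' nzfv.
have [[e hG0] G0f injf] := inj.
(* The second factor makes the gradient of H nonzero even if G0 is constant. *)
pose W := (G0 \mPo [tuple H^`M(i) | i < 3]) * H^`M(i).
have WE p : W.@[p 0] = G0.@[(gradient H p) 0] * gradient H p 0 i.
  rewrite mevalM comp_mpoly_meval mxE; congr (_ * _).
  by apply: meval_eq => j; rewrite tnth_mktuple mxE.
have hW : W \is (k.-1 * e + k.-1).-homog.
  apply: dhomogM; last exact: mderiv_homog.
  by apply: comp_mpoly_homog hG0 _ => j; rewrite tnth_mktuple mderiv_homog.
exists W; split; first by exists (k.-1 * e + k.-1)%N.
- have [u u0] := mpoly_nonroot_proj (mulf_neq0 Hi G0f).
  rewrite mevalM mulf_eq0 negb_or -/(grad_comp H fv i) meval_grad_comp meval_param.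
  move=> /andP[hi gu]; apply: contraTneq isT => /comp_eq0P/(_ u u0)/eqP.
  rewrite WE mulf_eq0 (negPf hi) orbF; move: hi.
  have [c ->] := gradient_bidual n0 Hfv u0; rewrite mxE mulf_eq0 negb_or => /andP[c0 _].
  by rewrite (meval_homog _ _ hG0) mulf_eq0 expf_eq0 (negPf c0) andbF (negPf gu).
move=> u v u0 v0 Wu [c c0 E].
have Wv : W.@[(param_eval fv v) 0] != 0.
  by rewrite E (meval_homog _ _ hW) mulf_neq0 // expf_neq0.
have key w : w != 0 -> W.@[(param_eval fv w) 0] != 0 ->
    exists2 b, b != 0 & gradient H (param_eval fv w) = b *: param_eval f w.
  move=> w0; rewrite WE mulf_eq0 negb_or => /andP[_].
  have [b ->] := gradient_bidual n0 Hfv w0; rewrite mxE mulf_eq0 negb_or => /andP[b0 _].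
  by exists b.
have [b b0 Eb] := key u u0 Wu; have [b' b'0 Eb'] := key v v0 Wv.
apply: injf => //.
  move: Wu; rewrite WE Eb mulf_eq0 negb_or => /andP[+ _].
  by rewrite (meval_homog _ _ hG0) mulf_eq0 negb_or => /andP[].
have : gradient H (param_eval fv v) = c ^+ k.-1 *: gradient H (param_eval fv u).
  by apply/rowP => j; rewrite E !mxE (meval_homog _ _ (mderiv_homog _ hH)).
rewrite Eb Eb' => Ec; exists (b'^-1 * (c ^+ k.-1 * b)).
  by rewrite !mulf_neq0 ?invr_eq0 // expf_neq0.
by rewrite -!scalerA -Ec scalerA mulVf ?scale1r.
Qed.

Lemma dual_curve_equation : exists F, curve_equation (param_image fv) n F.
Proof.
have [W injW] := dual_injective_off; have hfv' i : tnth fv i \is n.-1.+1.-homog.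
  by rewrite prednK ?dual_degree_gt0.
by rewrite -{1}(prednK dual_degree_gt0); apply: param_curve_equation injW.
Qed.

(** Tangent lines lie on the image of fv, which is closed. Conversely a form that
    vanishes on the tangent lines vanishes at fv(v) for all v where some partial
    derivative of F(f) does not vanish, hence for all v. *)
Lemma dual_curve_param : dual_curve (param_image f) = param_image fv.
Proof.
have [Fv [_ _ hFv EFv _]] := dual_curve_equation.
have [F XF] := param_curve_equation hf nzf inj.
have vanish E e : curve_equation (param_image f) e E -> E \mPo f = 0.
  case=> _ _ _ XE _; apply/comp_eq0P => u u0.
  by have := param_image_mem u0 (nzf u0); rewrite XE => -[_ /(_ E erefl)].
apply/seteqP; split=> [p [p0 Hp]|p [p0 [u [u0 [c c0 Ep]]]]].
  rewrite EFv; split=> // _ ->; apply: Hp; split; first by exists n.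
  move=> l [e [E [q [XE [q0 [u [u0 [c c0 Eq]]]] gq ql]]]].
  have [_ _ hE _ _] := XE.
  have [b Eb] := gradient_dual (vanish _ _ XE) u0.
  suff [a] : exists a, l = a *: param_eval fv u.
    have := param_image_mem u0 (nzfv u0); rewrite EFv => -[_ /(_ Fv erefl) Fu] ->.
    by rewrite (meval_homog _ _ hFv) Fu mulr0.
  case: ql => a a0 ->; exists (a * (c ^+ e.-1 * b)).
  rewrite -!scalerA -Eb; congr (_ *: _); apply/rowP => i.
  by rewrite Eq !mxE (meval_homog _ _ (mderiv_homog _ hE)).
split=> // G [[k hG] HG]; rewrite Ep (meval_homog _ _ hG) -meval_param.
suff -> : G \mPo fv = 0 by rewrite meval0 mulr0.
have [_ F0 hF _ dF] := XF.
(* Every form vanishing on the curve is a multiple of F, so a partial derivative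
   that vanishes on it is zero for degree reasons; not all of them are. *)
have [i Fi] : exists i, F^`M(i) \mPo f != 0.
  apply: contrapT => nex.
  have dFi i : F^`M(i) = 0.
    apply: contrapT => /eqP Fi0; have [|Q E] := dF F^`M(i).
      split; first by exists d; apply: mderiv_homog hF.
      move=> q [q0 [v [v0 [b b0 ->]]]].
      rewrite (meval_homog _ _ (mderiv_homog i hF)) -meval_param.
      have -> : F^`M(i) \mPo f = 0 by apply: contrapT => /eqP ?; case: nex; exists i.
      by rewrite meval0 mulr0.
    have hFi := mderiv_homog i hF; rewrite E in hFi Fi0; have [j hQ] := dhomog_factor Fi0 hFi.
    have := dhomog_uniq Fi0 (dhomogM hQ hF) hFi.
    by move=> /eqP; rewrite addnS /= gtn_eqF // ltnS leq_addl.
  have /eqP := euler_homog hF; rewrite big1 => [|i _]; last by rewrite dFi mulr0.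
  by rewrite eq_sym -mulr_natr mulf_eq0 (negPf F0) -mpolyC_nat mpolyC_eq0 pnatr_eq0.
apply: (meval_density_proj Fi) => v v0; rewrite meval_param => Fiv; rewrite meval_param.
have gv : gradient F (param_eval f v) != 0.
  by apply: contraNneq Fiv => /rowP/(_ i); rewrite !mxE => ->.
apply: HG; exists d.+1, F, (param_eval f v); split=> //; first exact: (param_image_mem v0 (nzf v0)).
have [b Eb] := gradient_dual (vanish _ _ XF) v0.
apply: same_point_sym; exists b => //.
by apply: contraNneq gv => b0; rewrite Eb b0 scale0r.
Qed.

End Duality.
End Tangents.

(** * The dual parametrization *)

(** The theorem over any algebraically closed field with a norm, such as the
    complex numbers over a real closed field. *)
Lemma dual_parametrization (K : numClosedFieldType) (d : nat) (hd : (2 <= d)%N)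
  (f0 f1 f2 : {mpoly K[2]}) (C : set 'rV[K]_3)
  (hf : generic_1to1_param d [tuple f0; f1; f2] C)
  (A m01' m02' m12' : {mpoly K[2]})
  (hA : is_gcd A [:: jacobian_minor f0 f1; jacobian_minor f0 f2;
                     jacobian_minor f1 f2])
  (hm01 : jacobian_minor f0 f1 = m01' * A)
  (hm02 : jacobian_minor f0 f2 = m02' * A)
  (hm12 : jacobian_minor f1 f2 = m12' * A) :
  generic_1to1_param (curve_degree (dual_curve C))
    [tuple m12'; - m02'; m01'] (dual_curve C).
Proof.
case: hf => hom gcd1 <- gen.
case: d hd hom => // d hd hom.
have nz := gcd1_no_common_zero hom gcd1.
have [G inj] := generically_injective_off nz gen.
set f := [tuple f0; f1; f2] in hom gcd1 gen nz inj *.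
set fv := [tuple m12'; - m02'; m01'].
have fvE i : jacobian_cross f i = tnth fv i * A.
  have [e0 e1 e2] := crossE (param_deriv f 0) (param_deriv f 1).
  have [->|->|->] := ord3 i.
  - by rewrite -[RHS]hm12; apply: etrans e0 _; rewrite /param_deriv /jacobian_minor.
  - rewrite mulNr -hm02; apply: etrans e1 _; rewrite /param_deriv /jacobian_minor /=.
    by rewrite opprB [X in X - _]mulrC [X in _ - X]mulrC [X in X - _]mulrC.
  - by rewrite -[RHS]hm01; apply: etrans e2 _; rewrite /param_deriv /jacobian_minor.
have [k Jk] := jacobian_cross_neq0 hom nz.
have A0 : A != 0 by apply: contraNneq Jk => A0; rewrite fvE A0 mulr0.
have homJ i : jacobian_cross f i \is (d + d).-homog.
  have D j l : param_deriv f j l \is d.-homog by apply: (mderiv_homog _ (hom l)).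
  have [e0 e1 e2] := crossE (param_deriv f 0) (param_deriv f 1).
  by rewrite /jacobian_cross; have [->|->|->] := ord3 i; rewrite ?e0 ?e1 ?e2;
    apply: rpredB; apply: dhomogM.
(* The minors are forms, so their factors are forms too. *)
have [a homA] : exists e, A \is e.-homog.
  by apply: (@dhomog_factor _ _ (d + d) A (tnth fv k)); rewrite mulrC -fvE.
have homfv i : tnth fv i \is (d + d - a).-homog.
  have [->|fvi] := eqVneq (tnth fv i) 0; first exact: rpred0.
  have nzi := mulf_neq0 fvi A0; have := homJ i; rewrite fvE => hi.
  have [b hb] := dhomog_factor nzi hi.
  by rewrite -(dhomog_uniq nzi (dhomogM hb homA) hi) addnK.
have gcdv : is_gcd 1 fv.
  split=> [H _|B HB]; first by exists H; rewrite mulr1.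
  have BA : forall H, H \in [:: jacobian_minor f0 f1; jacobian_minor f0 f2; jacobian_minor f1 f2] ->
      mdivides (B * A) H.
    have [q0 E0] := HB m12' (mem_head _ _).
    have [|q1 E1] := HB (- m02'); first by rewrite !inE eqxx orbT.
    have [|q2 E2] := HB m01'; first by rewrite !inE eqxx !orbT.
    move=> H; rewrite !inE => /or3P[] /eqP ->.
    - by exists q2; rewrite hm01 E2 mulrA.
    - by exists (- q1); rewrite hm02 mulrA mulNr -E1 opprK.
    - by exists q0; rewrite hm12 E0 mulrA.
  have [Q E] := hA.2 _ BA; exists Q.
  by apply: (mulIf A0); rewrite mul1r {1}E mulrA.
have nzv := gcd1_no_common_zero homfv gcdv.
have [W injW] := dual_injective_off hom nz homfv nzv A0 fvE inj hd.
have dualE := dual_curve_param hom nz homfv nzv A0 fvE inj hd.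
have [F XF] := dual_curve_equation hom nz homfv nzv A0 fvE inj hd.
rewrite dualE (curve_degreeE XF); split=> //.
exact: injective_off_generically homfv nzv injW.
Qed.

Theorem theorem3p4 (R : realType) (d : nat) (hd : (2 <= d)%N)
  (f0 f1 f2 : {mpoly R[i][2]}) (C : set 'rV[R[i]]_3)
  (hf : generic_1to1_param d [tuple f0; f1; f2] C)
  (A m01' m02' m12' : {mpoly R[i][2]})
  (hA : is_gcd A [:: jacobian_minor f0 f1; jacobian_minor f0 f2;
                     jacobian_minor f1 f2])
  (hm01 : jacobian_minor f0 f1 = m01' * A)
  (hm02 : jacobian_minor f0 f2 = m02' * A)
  (hm12 : jacobian_minor f1 f2 = m12' * A) :
  generic_1to1_param (curve_degree (dual_curve C))
    [tuple m12'; - m02'; m01'] (dual_curve C).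
Proof. exact: (dual_parametrization hd hf hA hm01 hm02 hm12). Qed.
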